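(* Let $M$ be a countable model of $\mathrm{I}\Delta_0+\exp$ and let $n\in\mathbb{N}$. Then $M\models\mathrm{I}\Sigma_{n+2}$ if and only if $M$ admits a proper end extension $K$ with $M\preccurlyeq_{\Sigma_{n+2}}K$ and $K\models M\text{-}\mathrm{I}\Sigma_{n+1}$.
   Context: $\mathrm{I}\Sigma_k$ is the $\Sigma_k$-induction scheme (over $\mathrm{PA}^-$). $M\preccurlyeq_{\Sigma_k}K$: every $\Sigma_k$ formula with parameters from $M$ has the same truth value in $M$ and $K$; end extension: every element of $K\setminus M$ exceeds every element of $M$; proper: $K\neq M$. For an end extension $M\subseteq K$ of models of $\mathrm{I}\Delta_0+\exp$, $K\models M\text{-}\mathrm{I}\Sigma_{n+1}$ means: for every $\Sigma_{n+1}$ formula $\phi(x)$ with parameters from $K$ and every $a\in M$, $K\models\phi(0)\wedge\forall x<a(\phi(x)\to\phi(x+1))\to\forall x<a\,\phi(x)$. *)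

(* Defs.v *)
From Stdlib Require Import Arith.

Inductive term : Type :=
| tvar : nat -> term
| tzero : term
| tone : term
| tadd : term -> term -> term
| tmul : term -> term -> term.

(* [fball t p] is the bounded quantifier  forall x < t, p  and
   [fbex t p] is  exists x < t, p ; the bound [t] lives in the outer
   context (it cannot mention the bound variable), [p] in the context
   extended by the new variable (de Bruijn index 0). *)
Inductive form : Type :=
| feq : term -> term -> form
| flt : term -> term -> form
| fbot : form
| fneg : form -> form
| fand : form -> form -> form
| f_or : form -> form -> form
| fimp : form -> form -> form
| fall : form -> form
| fex : form -> form
| fball : term -> form -> form
| fbex : term -> form -> form.

Record structure : Type := Structure {
  dom :> Type;
  s_zero : dom;
  s_one : dom;
  s_add : dom -> dom -> dom;
  s_mul : dom -> dom -> dom;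
  s_lt : dom -> dom -> Prop
}.

Definition scons {D : Type} (x : D) (e : nat -> D) : nat -> D :=
  fun n => match n with 0 => x | S m => e m end.

Fixpoint eval (M : structure) (e : nat -> M) (t : term) : M :=
  match t with
  | tvar n => e n
  | tzero => s_zero M
  | tone => s_one M
  | tadd a b => s_add M (eval M e a) (eval M e b)
  | tmul a b => s_mul M (eval M e a) (eval M e b)
  end.

Fixpoint sat (M : structure) (e : nat -> M) (p : form) : Prop :=
  match p with
  | feq a b => eval M e a = eval M e b
  | flt a b => s_lt M (eval M e a) (eval M e b)
  | fbot => False
  | fneg q => ~ sat M e q
  | fand q r => sat M e q /\ sat M e r
  | f_or q r => sat M e q \/ sat M e r
  | fimp q r => sat M e q -> sat M e r
  | fall q => forall x : M, sat M (scons x e) q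
  | fex q => exists x : M, sat M (scons x e) q
  | fball t q => forall x : M, s_lt M x (eval M e t) -> sat M (scons x e) q
  | fbex t q => exists x : M, s_lt M x (eval M e t) /\ sat M (scons x e) q
  end.

Inductive Delta0 : form -> Prop :=
| D0eq : forall a b, Delta0 (feq a b)
| D0lt : forall a b, Delta0 (flt a b)
| D0bot : Delta0 fbot
| D0neg : forall p, Delta0 p -> Delta0 (fneg p)
| D0and : forall p q, Delta0 p -> Delta0 q -> Delta0 (fand p q)
| D0or : forall p q, Delta0 p -> Delta0 q -> Delta0 (f_or p q)
| D0imp : forall p q, Delta0 p -> Delta0 q -> Delta0 (fimp p q)
| D0ball : forall t p, Delta0 p -> Delta0 (fball t p)
| D0bex : forall t p, Delta0 p -> Delta0 (fbex t p).

Inductive Sigma : nat -> form -> Prop :=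
| Sig0 : forall p, Delta0 p -> Sigma 0 p
| SigPi : forall k p, Pi k p -> Sigma (S k) p
| SigEx : forall k p, Sigma (S k) p -> Sigma (S k) (fex p)
with Pi : nat -> form -> Prop :=
| Pi0 : forall p, Delta0 p -> Pi 0 p
| PiSig : forall k p, Sigma k p -> Pi (S k) p
| PiAll : forall k p, Pi (S k) p -> Pi (S k) (fall p).

(* PA^- : the theory of nonnegative parts of discretely ordered rings (Kaye). *)
Definition PAminus (M : structure) : Prop :=
  let z := s_zero M in let o := s_one M in
  let add := s_add M in let mul := s_mul M in let lt := s_lt M in
  (forall x y, add x y = add y x) /\
  (forall x y w, add (add x y) w = add x (add y w)) /\
  (forall x y, mul x y = mul y x) /\
  (forall x y w, mul (mul x y) w = mul x (mul y w)) /\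
  (forall x y w, mul x (add y w) = add (mul x y) (mul x w)) /\
  (forall x, add x z = x) /\
  (forall x, mul x z = z) /\
  (forall x, mul x o = x) /\
  (forall x, ~ lt x x) /\
  (forall x y w, lt x y -> lt y w -> lt x w) /\
  (forall x y, lt x y \/ x = y \/ lt y x) /\
  (forall x y w, lt x y -> lt (add x w) (add y w)) /\
  (forall x y w, lt z w -> lt x y -> lt (mul x w) (mul y w)) /\
  (forall x y, lt x y -> exists w, add x w = y) /\
  lt z o /\
  (forall x, lt z x -> o = x \/ lt o x) /\
  (forall x, z = x \/ lt z x).

Definition induction_instance (M : structure) (p : form) : Prop :=
  forall e : nat -> M,
    sat M (scons (s_zero M) e) p ->
    (forall x : M, sat M (scons x e) p -> sat M (scons (s_add M x (s_one M)) e) p) ->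
    forall x : M, sat M (scons x e) p.

Definition IDelta0 (M : structure) : Prop :=
  PAminus M /\ forall p, Delta0 p -> induction_instance M p.

Definition ISigma (k : nat) (M : structure) : Prop :=
  PAminus M /\ forall p, Sigma k p -> induction_instance M p.

(* The axiom exp ("2^x exists for every x"): some Delta_0 formula (with
   parameters) E(x,y)  [x = variable 0, y = variable 1]  defines in M a total
   function satisfying the recursion 2^0 = 1, 2^(x+1) = 2^x + 2^x. *)
Definition Exp_axiom (M : structure) : Prop :=
  exists (p : form) (e : nat -> M), Delta0 p /\
    let E x y := sat M (scons x (scons y e)) p in
    E (s_zero M) (s_one M) /\
    (forall x y, E x y -> E (s_add M x (s_one M)) (s_add M y y)) /\
    (forall x y y', E x y -> E x y' -> y = y') /\
    (forall x, exists y, E x y).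

Definition IDelta0_exp (M : structure) : Prop := IDelta0 M /\ Exp_axiom M.

Definition countable (M : structure) : Prop :=
  exists f : M -> nat, forall x y, f x = f y -> x = y.

Definition embedding (M K : structure) (f : M -> K) : Prop :=
  (forall x y, f x = f y -> x = y) /\
  f (s_zero M) = s_zero K /\
  f (s_one M) = s_one K /\
  (forall x y, f (s_add M x y) = s_add K (f x) (f y)) /\
  (forall x y, f (s_mul M x y) = s_mul K (f x) (f y)) /\
  (forall x y, s_lt M x y <-> s_lt K (f x) (f y)).

Definition end_extension (M K : structure) (f : M -> K) : Prop :=
  embedding M K f /\
  forall k : K, (forall m : M, f m <> k) -> forall m : M, s_lt K (f m) k.

Definition proper (M K : structure) (f : M -> K) : Prop :=
  exists k : K, forall m : M, f m <> k.

Definition Sigma_elementary (k : nat) (M K : structure) (f : M -> K) : Prop :=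
  forall p, Sigma k p -> forall e : nat -> M,
    sat M e p <-> sat K (fun n => f (e n)) p.

Definition M_ISigma (k : nat) (M K : structure) (f : M -> K) : Prop :=
  forall p, Sigma k p -> forall (e : nat -> K) (a : M),
    sat K (scons (s_zero K) e) p ->
    (forall x : K, s_lt K x (f a) ->
       sat K (scons x e) p -> sat K (scons (s_add K x (s_one K)) e) p) ->
    forall x : K, s_lt K x (f a) -> sat K (scons x e) p.

(* Main.v *)
Require Import Defs.
From Stdlib Require Import Arith Lia Classical ClassicalEpsilon FunctionalExtensionality PropExtensionality Cantor.

(** If [K] is a proper end extension as in the theorem and [d] lies above [M], then, level by level,
    elementarity turns the bound [d] into collection in [M] up to [B Sigma_{n+1}] and carries it
    over to [K] up to [B Sigma_n].  For a [Sigma_{n+2}] formula [exists y, forall z, sigma] with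
    parameters in [M], the [Sigma_{n+1}] formula
    [exists w, forall y < d, exists z < w, ~ sigma] then defines its complement on [M] inside [K],
    so induction up to elements of [M] in [K] gives [Sigma_{n+2}] induction in [M].

    Conversely, [K] is an ultrapower of [M] by functions with [Sigma_{n+1}] graph, modulo a filter
    generated by a decreasing sequence of cofinal [Sigma_{n+1}] sets.  Given such a set [A], a
    [Sigma_{n+1}] relation [R(i, x)] and a bound [a], let [x <= a] be largest such that the
    [i \in A] with [R(i, 0), ..., R(i, x)] are cofinal; it exists by [I Sigma_{n+2}].  Shrinking
    [A] to these [i] decides [R] below [a].  Meeting all these countably many requirements gives
    Los' theorem for [Sigma_{n+1}] formulas (hence [Sigma_{n+2}]-elementarity), makes every germ
    bounded by an element of [M] constant, and yields [Sigma_{n+1}] induction up to elements of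
    [M]. *)

(** * Substitution in terms and formulas *)

Fixpoint tsub (s : nat -> term) (t : term) : term :=
  match t with
  | tvar n => s n
  | tzero => tzero
  | tone => tone
  | tadd a b => tadd (tsub s a) (tsub s b)
  | tmul a b => tmul (tsub s a) (tsub s b)
  end.

(** Most renamings below have the form [scons (tvar i) (... (shift m))]: the leading entries place
    the variables in focus, and [shift m] moves the remaining parameters past the [m] newest
    variables. *)
Definition shift (m : nat) : nat -> term := fun j => tvar (m + j).

Definition up (s : nat -> term) : nat -> term :=
  scons (tvar 0) (fun j => tsub (shift 1) (s j)).

Fixpoint fsub (s : nat -> term) (p : form) : form :=
  match p with
  | feq a b => feq (tsub s a) (tsub s b)
  | flt a b => flt (tsub s a) (tsub s b)
  | fbot => fbot
  | fneg q => fneg (fsub s q)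
  | fand q r => fand (fsub s q) (fsub s r)
  | f_or q r => f_or (fsub s q) (fsub s r)
  | fimp q r => fimp (fsub s q) (fsub s r)
  | fall q => fall (fsub (up s) q)
  | fex q => fex (fsub (up s) q)
  | fball t q => fball (tsub s t) (fsub (up s) q)
  | fbex t q => fbex (tsub s t) (fsub (up s) q)
  end.

Lemma eval_tsub (M : structure) s t : forall e : nat -> M,
  eval M e (tsub s t) = eval M (fun j => eval M e (s j)) t.
Proof. induction t; intros e; simpl; try reflexivity; rewrite IHt1, IHt2; reflexivity. Qed.

Lemma eval_scons (M : structure) (e : nat -> M) t s :
  (fun j => eval M e (scons t s j)) = scons (eval M e t) (fun j => eval M e (s j)).
Proof. apply functional_extensionality; intros [|j]; reflexivity. Qed.

Lemma scons_eta {D : Type} (e : nat -> D) : scons (e 0) (fun j => e (S j)) = e.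
Proof. apply functional_extensionality; intros [|j]; reflexivity. Qed.

Lemma eval_up (M : structure) (e : nat -> M) x s :
  (fun j => eval M (scons x e) (up s j)) = scons x (fun j => eval M e (s j)).
Proof.
  unfold up; rewrite eval_scons; f_equal.
  apply functional_extensionality; intros j; rewrite eval_tsub; reflexivity.
Qed.

Lemma sat_fsub (M : structure) p : forall s (e : nat -> M),
  sat M e (fsub s p) <-> sat M (fun j => eval M e (s j)) p.
Proof.
  induction p; intros s e; simpl; rewrite ?eval_tsub; try reflexivity;
    try (rewrite IHp; reflexivity); try (rewrite IHp1, IHp2; reflexivity);
    (split; [intros H | intros H]).
  - intros x; rewrite <- eval_up; apply IHp, H.
  - intros x; apply IHp; rewrite eval_up; apply H.
  - destruct H as [x H]; exists x; rewrite <- eval_up; apply IHp, H.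
  - destruct H as [x H]; exists x; apply IHp; rewrite eval_up; apply H.
  - intros x Hx; rewrite <- eval_up; apply IHp, H, Hx.
  - intros x Hx; apply IHp; rewrite eval_up; apply H, Hx.
  - destruct H as [x [Hx H]]; exists x; split; [exact Hx|]. rewrite <- eval_up; apply IHp, H.
  - destruct H as [x [Hx H]]; exists x; split; [exact Hx|]. apply IHp; rewrite eval_up; apply H.
Qed.

(* Syntactic properties of the arithmetical hierarchy *)
Scheme Sigma_mut := Minimality for Sigma Sort Prop
  with Pi_mut := Minimality for Pi Sort Prop.
Combined Scheme Sigma_Pi_ind from Sigma_mut, Pi_mut.

Lemma Delta0_fsub p : Delta0 p -> forall s, Delta0 (fsub s p).
Proof. induction 1; intros s; simpl; constructor; auto. Qed.

Lemma Sigma_Pi_fsub :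
  (forall k p, Sigma k p -> forall s, Sigma k (fsub s p)) /\
  (forall k p, Pi k p -> forall s, Pi k (fsub s p)).
Proof.
  apply Sigma_Pi_ind; intros; simpl.
  - apply Sig0, Delta0_fsub; assumption.
  - apply SigPi; auto.
  - apply SigEx; auto.
  - apply Pi0, Delta0_fsub; assumption.
  - apply PiSig; auto.
  - apply PiAll; auto.
Qed.

Lemma Sigma_Pi_succ :
  (forall k p, Sigma k p -> Sigma (S k) p) /\ (forall k p, Pi k p -> Pi (S k) p).
Proof.
  apply Sigma_Pi_ind; intros.
  - apply SigPi, Pi0; assumption.
  - apply SigPi; assumption.
  - apply SigEx; assumption.
  - apply PiSig, Sig0; assumption.
  - apply PiSig; assumption.
  - apply PiAll; assumption.
Qed.

Lemma Sigma_le k l p : k <= l -> Sigma k p -> Sigma l p.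
Proof. induction 1; intros; [assumption|]. apply Sigma_Pi_succ; auto. Qed.

Lemma Pi_le k l p : k <= l -> Pi k p -> Pi l p.
Proof. induction 1; intros; [assumption|]. apply Sigma_Pi_succ; auto. Qed.

(** With the level fixed, induction runs only along the leading existential block and treats $\Pi_k$
    formulas as the base case, instead of descending through all levels. *)
Lemma Sigma_succ_ind k (P : form -> Prop) :
  (forall p, Pi k p -> P p) -> (forall p, Sigma (S k) p -> P p -> P (fex p)) ->
  forall p, Sigma (S k) p -> P p.
Proof.
  intros H1 H2 p H; remember (S k) as l eqn:E; revert k E H1 H2.
  induction H; intros k' E H1 H2; try discriminate; injection E as ->; auto.
  apply H2; [assumption|]. apply (IHSigma k'); auto.
Qed.

(** * Finite support of terms and formulas *)

Lemma eval_support (M : structure) t : exists N, forall e e' : nat -> M,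
  (forall j, j < N -> e j = e' j) -> eval M e t = eval M e' t.
Proof.
  induction t as [n | | | a [N1 H1] b [N2 H2] | a [N1 H1] b [N2 H2]].
  - exists (S n); intros e e' H; apply H; lia.
  - exists 0; reflexivity.
  - exists 0; reflexivity.
  - exists (N1 + N2); intros e e' H; simpl; f_equal; [apply H1 | apply H2];
      intros; apply H; lia.
  - exists (N1 + N2); intros e e' H; simpl; f_equal; [apply H1 | apply H2];
      intros; apply H; lia.
Qed.

(** One implication suffices, the assumption on [e] and [e'] being symmetric. The bound reduces
    whole environments to finitely many variables, which can be quantified out one by one or handled
    by finite intersections in a filter. *)
Lemma sat_support (M : structure) p : exists N, forall e e' : nat -> M,
  (forall j, j < N -> e j = e' j) -> sat M e p -> sat M e' p.
Proof.
  assert (Hs : forall N (e e' : nat -> M) x, (forall j, j < N -> e j = e' j) ->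
    forall j, j < N -> scons x e j = scons x e' j).
  { intros N e e' x H [|j] Hj; simpl; [reflexivity|]. apply H; lia. }
  induction p as [a b|a b| |q [N H]|q [N H] r [N' H']|q [N H] r [N' H']|q [N H] r [N' H']
    |q [N H]|q [N H]|t q [N H]|t q [N H]].
  - destruct (eval_support M a) as [N1 H1], (eval_support M b) as [N2 H2].
    exists (N1 + N2); intros e e' H; simpl.
    rewrite (H1 e e'), (H2 e e') by (intros; apply H; lia). auto.
  - destruct (eval_support M a) as [N1 H1], (eval_support M b) as [N2 H2].
    exists (N1 + N2); intros e e' H; simpl.
    rewrite (H1 e e'), (H2 e e') by (intros; apply H; lia). auto.
  - exists 0; auto.
  - exists N; intros e e' He Hq Hq'; apply Hq; apply (H e'); auto.
    intros; symmetry; auto.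
  - exists (N + N'); intros e e' He [Hq Hr]; split; [apply (H e)|apply (H' e)]; auto;
      intros; apply He; lia.
  - exists (N + N'); intros e e' He [Hq|Hq]; [left; apply (H e)|right; apply (H' e)]; auto;
      intros; apply He; lia.
  - exists (N + N'); intros e e' He Hq Hr. apply (H' e); [intros; apply He; lia|].
    apply Hq, (H e'); auto. intros; symmetry; apply He; lia.
  - exists N; intros e e' He Hq x; apply (H (scons x e)); eauto.
  - exists N; intros e e' He [x Hq]; exists x; apply (H (scons x e)); eauto.
  - destruct (eval_support M t) as [N1 H1].
    exists (N + N1); intros e e' He Hq x Hx. apply (H (scons x e)).
    + apply Hs; intros; apply He; lia.
    + apply Hq. rewrite (H1 e e'); auto. intros; apply He; lia.
  - destruct (eval_support M t) as [N1 H1].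
    exists (N + N1); intros e e' He [x [Hx Hq]]; exists x; split.
    + rewrite <- (H1 e e'); auto. intros; apply He; lia.
    + apply (H (scons x e)); [|exact Hq]. apply Hs; intros; apply He; lia.
Qed.

(** * Order and successor in models of $\mathrm{PA}^-$ *)

Section OrderFacts.
Context (M : structure) (HM : PAminus M).
Let z := s_zero M.
Let o := s_one M.
Let add := s_add M.
Let lt := s_lt M.

Lemma add_comm x y : add x y = add y x.
Proof. apply HM. Qed.
Lemma add_assoc x y w : add (add x y) w = add x (add y w).
Proof. apply HM. Qed.
Lemma add_zero x : add x z = x.
Proof. apply HM. Qed.
Lemma lt_irrefl x : ~ lt x x.
Proof. apply HM. Qed.
Lemma lt_trans x y w : lt x y -> lt y w -> lt x w.
Proof. apply HM. Qed.
Lemma lt_total x y : lt x y \/ x = y \/ lt y x.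
Proof. apply HM. Qed.
Lemma add_lt x y w : lt x y -> lt (add x w) (add y w).
Proof. apply HM. Qed.
Lemma lt_diff x y : lt x y -> exists w, add x w = y.
Proof. apply HM. Qed.
Lemma zero_lt_one : lt z o.
Proof. apply HM. Qed.
Lemma one_le x : lt z x -> o = x \/ lt o x.
Proof. apply HM. Qed.
Lemma zero_le x : z = x \/ lt z x.
Proof. apply HM. Qed.

Lemma lt_succ x : lt x (add x o).
Proof.
  generalize (add_lt _ _ x zero_lt_one). rewrite (add_comm z x), (add_comm o x), add_zero; auto.
Qed.

Lemma not_lt_zero x : ~ lt x z.
Proof.
  intros H. destruct (zero_le x) as [<-|H']; [exact (lt_irrefl _ H)|].
  exact (lt_irrefl _ (lt_trans _ _ _ H H')).
Qed.

Lemma succ_le x y : lt x y -> add x o = y \/ lt (add x o) y.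
Proof.
  intros H. destruct (lt_diff _ _ H) as [w <-].
  destruct (zero_le w) as [<-|Hw]; [rewrite add_zero in H; destruct (lt_irrefl _ H)|].
  destruct (one_le _ Hw) as [<-|Hw']; [left; reflexivity|right].
  rewrite (add_comm x o), (add_comm x w); apply add_lt, Hw'.
Qed.

Lemma lt_succ_iff x y : lt x (add y o) <-> lt x y \/ x = y.
Proof.
  split.
  - intros H. destruct (lt_total x y) as [H'|[H'|H']]; auto.
    destruct (succ_le _ _ H') as [<-|H'']; [destruct (lt_irrefl _ H)|].
    destruct (lt_irrefl _ (lt_trans _ _ _ H H'')).
  - intros [H| ->]; [apply (lt_trans _ _ _ H)|]; apply lt_succ.
Qed.

Lemma zero_lt_succ x : lt z (add x o).
Proof. apply lt_succ_iff. destruct (zero_le x); auto. Qed.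

Lemma pred_exists x : z = x \/ exists y, x = add y o.
Proof.
  destruct (zero_le x) as [H|H]; [auto|right].
  destruct (one_le _ H) as [<-|H'].
  - exists z. rewrite add_comm, add_zero; reflexivity.
  - destruct (lt_diff _ _ H') as [w <-]; exists w; apply add_comm.
Qed.

Lemma not_lt x y : ~ lt x y -> lt y (add x o).
Proof. intros H; apply lt_succ_iff. destruct (lt_total x y) as [|[|]]; auto; tauto. Qed.

Lemma upper_bound x y : exists b, lt x b /\ lt y b.
Proof.
  destruct (lt_total x y) as [H|[->|H]].
  - exists (add y o); split; [apply (lt_trans _ _ _ H)|]; apply lt_succ.
  - exists (add y o); split; apply lt_succ.
  - exists (add x o); split; [|apply (lt_trans _ _ _ H)]; apply lt_succ.
Qed.

Lemma add_cancel x y w : add x w = add y w -> x = y.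
Proof.
  intros H. destruct (lt_total x y) as [H'|[H'|H']]; auto;
    apply add_lt with (w := w) in H'; rewrite H in H'; destruct (lt_irrefl _ H').
Qed.

Lemma add_succ_l x y : add (add x o) y = add x (add y o).
Proof. rewrite add_assoc, (add_comm o y); reflexivity. Qed.

End OrderFacts.

(* The scheme B Sigma_{k+1}. *)
Definition collection (k : nat) (M : structure) : Prop :=
  forall p, Pi k p -> forall (e : nat -> M) (a : M),
    (forall x, s_lt M x a -> exists y, sat M (scons y (scons x e)) p) ->
    exists b, forall x, s_lt M x a ->
      exists y, s_lt M y b /\ sat M (scons y (scons x e)) p.

(** * Definability up to uniform equivalence in a family of structures *)

Section Definability.
Context {I : Type} (St : I -> structure).

Definition equiv (p q : form) : Prop :=
  forall i (e : nat -> St i), sat (St i) e p <-> sat (St i) e q.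

(** A single [q] must serve every structure of the family. For the family $M$, $K$ this lets
    elementarity, stated for syntactic classes, apply to formulas merely equivalent to members of a
    class. *)
Definition sg (k : nat) (p : form) : Prop := exists q, Sigma k q /\ equiv p q.
Definition pg (k : nat) (p : form) : Prop := exists q, Pi k q /\ equiv p q.

Lemma sg_equiv k p q : equiv p q -> sg k p -> sg k q.
Proof. intros E [r [Hr E']]; exists r; split; auto. intros i e; rewrite <- (E i e); apply E'. Qed.

Lemma pg_equiv k p q : equiv p q -> pg k p -> pg k q.
Proof. intros E [r [Hr E']]; exists r; split; auto. intros i e; rewrite <- (E i e); apply E'. Qed.

Lemma equiv_sym p q : equiv p q -> equiv q p.
Proof. intros H i e; symmetry; apply H. Qed.

Lemma Sigma_sg k p : Sigma k p -> sg k p.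
Proof. intros H; exists p; split; auto; intros i e; reflexivity. Qed.

Lemma Pi_pg k p : Pi k p -> pg k p.
Proof. intros H; exists p; split; auto; intros i e; reflexivity. Qed.

Lemma sg_Delta0 k p : Delta0 p -> sg k p.
Proof. intros H; apply Sigma_sg, (Sigma_le 0); [lia|apply Sig0, H]. Qed.

Lemma pg_Delta0 k p : Delta0 p -> pg k p.
Proof. intros H; apply Pi_pg, (Pi_le 0); [lia|apply Pi0, H]. Qed.

Lemma sg_le k l p : k <= l -> sg k p -> sg l p.
Proof. intros H [q [Hq E]]; exists q; split; [apply (Sigma_le k); auto|exact E]. Qed.

Lemma pg_le k l p : k <= l -> pg k p -> pg l p.
Proof. intros H [q [Hq E]]; exists q; split; [apply (Pi_le k); auto|exact E]. Qed.

Lemma pg_sg k l p : k < l -> pg k p -> sg l p.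
Proof.
  intros H [q [Hq E]]; exists q; split; [apply (Sigma_le (S k)); auto|exact E].
  apply SigPi, Hq.
Qed.

Lemma sg_pg k l p : k < l -> sg k p -> pg l p.
Proof.
  intros H [q [Hq E]]; exists q; split; [apply (Pi_le (S k)); auto|exact E].
  apply PiSig, Hq.
Qed.

Lemma sg_fsub k p s : sg k p -> sg k (fsub s p).
Proof.
  intros [q [Hq E]]; exists (fsub s q); split; [apply Sigma_Pi_fsub, Hq|].
  intros i e; rewrite !sat_fsub; apply E.
Qed.

Lemma pg_fsub k p s : pg k p -> pg k (fsub s p).
Proof.
  intros [q [Hq E]]; exists (fsub s q); split; [apply Sigma_Pi_fsub, Hq|].
  intros i e; rewrite !sat_fsub; apply E.
Qed.

Lemma sg_ex k p : sg (S k) p -> sg (S k) (fex p).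
Proof.
  intros [q [Hq E]]; exists (fex q); split; [apply SigEx, Hq|].
  intros i e; simpl; split; intros [x H]; exists x; apply E, H.
Qed.

Lemma pg_all k p : pg (S k) p -> pg (S k) (fall p).
Proof.
  intros [q [Hq E]]; exists (fall q); split; [apply PiAll, Hq|].
  intros i e; simpl; split; intros H x; apply E, H.
Qed.

Lemma Sigma_Pi_neg :
  (forall k p, Sigma k p -> pg k (fneg p)) /\ (forall k p, Pi k p -> sg k (fneg p)).
Proof.
  apply Sigma_Pi_ind; intros.
  - apply pg_Delta0; constructor; assumption.
  - apply (sg_pg k); auto.
  - apply (pg_equiv _ (fall (fneg p))); [|apply pg_all; assumption].
    intros i e; simpl; split; [intros Hn [x Hx]; exact (Hn x Hx)|intros Hn x Hx; eauto].
  - apply sg_Delta0; constructor; assumption.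
  - apply (pg_sg k); auto.
  - apply (sg_equiv _ (fex (fneg p))); [|apply sg_ex; assumption].
    intros i e; simpl; split; [intros [x Hx] Hn; auto|]. apply not_all_ex_not.
Qed.

Lemma pg_neg k p : sg k p -> pg k (fneg p).
Proof.
  intros [q [Hq E]]. apply (pg_equiv _ (fneg q)); [|apply Sigma_Pi_neg, Hq].
  intros i e; simpl; rewrite (E i e); reflexivity.
Qed.

Lemma sg_neg k p : pg k p -> sg k (fneg p).
Proof.
  intros [q [Hq E]]. apply (sg_equiv _ (fneg q)); [|apply Sigma_Pi_neg, Hq].
  intros i e; simpl; rewrite (E i e); reflexivity.
Qed.

Lemma sg_0_inv p : sg 0 p -> exists q, Delta0 q /\ equiv p q.
Proof. intros [q [Hq E]]; exists q; split; auto. inversion Hq; auto. Qed.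

Lemma sg_succ_ind k (P : form -> Prop) :
  (forall p q, equiv p q -> P p -> P q) ->
  (forall p, pg k p -> P p) -> (forall p, sg (S k) p -> P p -> P (fex p)) ->
  forall p, sg (S k) p -> P p.
Proof.
  intros H0 H1 H2 p [q [Hq E]]. apply (H0 q); [apply equiv_sym, E|].
  revert Hq; apply Sigma_succ_ind; clear p q E.
  - intros p Hp; apply H1, Pi_pg, Hp.
  - intros p Hp; apply H2, Sigma_sg, Hp.
Qed.

Lemma equiv_op (op : form -> form -> form) :
  op = fand \/ op = f_or -> forall p p' q q', equiv p p' -> equiv q q' ->
  equiv (op p q) (op p' q').
Proof.
  intros [->| ->] p p' q q' E E' i e; simpl; rewrite (E i e), (E' i e); reflexivity.
Qed.

Lemma equiv_op_ex (op : form -> form -> form) :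
  op = fand \/ op = f_or -> forall p q,
  equiv (op (fex p) q) (fex (op p (fsub (shift 1) q))) /\
  equiv (op q (fex p)) (fex (op (fsub (shift 1) q) p)).
Proof.
  intros [->| ->] p q; split; intros i e; simpl; split.
  - intros [[x H] H']; exists x; rewrite sat_fsub; auto.
  - intros [x [H H']]; rewrite sat_fsub in H'; eauto.
  - intros [H' [x H]]; exists x; rewrite sat_fsub; auto.
  - intros [x [H' H]]; rewrite sat_fsub in H'; eauto.
  - intros [[x H]|H]; [exists x|exists (s_zero _)]; rewrite sat_fsub; auto.
  - intros [x [H|H]]; rewrite ?sat_fsub in H; eauto.
  - intros [H|[x H]]; [exists (s_zero _)|exists x]; rewrite sat_fsub; auto.
  - intros [x [H|H]]; rewrite ?sat_fsub in H; eauto.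
Qed.

(** Both connectives go through one induction on [k]: by De Morgan, closure of $\Pi_k$ under one
    comes from closure of $\Sigma_k$ under the other. At level $k+1$ the existential blocks of both
    arguments are pulled out quantifier by quantifier. *)
Lemma sg_op k : forall op, op = fand \/ op = f_or ->
  forall p q, sg k p -> sg k q -> sg k (op p q).
Proof.
  induction k as [|k IH]; intros op Hop.
  - intros p q Hp Hq. apply sg_0_inv in Hp as [p' [Hp E]], Hq as [q' [Hq E']].
    apply (sg_equiv _ (op p' q')); [apply equiv_op; auto using equiv_sym|].
    apply sg_Delta0; destruct Hop as [->| ->]; constructor; assumption.
  - assert (H0 : forall p q, pg k p -> pg k q -> pg k (op p q)).
    { intros p q Hp Hq. destruct Hop as [->| ->].
      - apply (pg_equiv _ (fneg (f_or (fneg p) (fneg q)))).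
        + intros i e; simpl; tauto.
        + apply pg_neg, IH; auto using sg_neg.
      - apply (pg_equiv _ (fneg (fand (fneg p) (fneg q)))).
        + intros i e; simpl; tauto.
        + apply pg_neg, IH; auto using sg_neg. }
    assert (H1 : forall q, sg (S k) q -> forall p, pg k p -> sg (S k) (op p q)).
    { apply (sg_succ_ind k (fun q => forall p, pg k p -> sg (S k) (op p q))).
      - intros q q' E H p Hp. apply (sg_equiv _ (op p q)); auto.
        apply equiv_op; auto. intros i e; reflexivity.
      - intros q Hq p Hp; apply (pg_sg k); auto.
      - intros q Hq H p Hp.
        eapply sg_equiv; [apply equiv_sym, (equiv_op_ex op Hop)|].
        apply sg_ex, H, pg_fsub, Hp. }
    intros p q Hp; revert p Hp q.
    apply (sg_succ_ind k (fun p => forall q, sg (S k) q -> sg (S k) (op p q))).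
    + intros p p' E H q Hq. apply (sg_equiv _ (op p q)); auto.
      apply equiv_op; auto. intros i e; reflexivity.
    + intros p Hp q Hq; apply H1; assumption.
    + intros p Hp H q Hq.
      eapply sg_equiv; [apply equiv_sym, (equiv_op_ex op Hop)|].
      apply sg_ex, H, sg_fsub, Hq.
Qed.

Lemma sg_and k p q : sg k p -> sg k q -> sg k (fand p q).
Proof. apply (sg_op k fand); auto. Qed.

Lemma sg_or k p q : sg k p -> sg k q -> sg k (f_or p q).
Proof. apply (sg_op k f_or); auto. Qed.

Lemma pg_and k p q : pg k p -> pg k q -> pg k (fand p q).
Proof.
  intros. apply (pg_equiv _ (fneg (f_or (fneg p) (fneg q)))).
  - intros i e; simpl; tauto.
  - apply pg_neg, sg_or; apply sg_neg; auto.
Qed.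

Lemma pg_or k p q : pg k p -> pg k q -> pg k (f_or p q).
Proof.
  intros. apply (pg_equiv _ (fneg (fand (fneg p) (fneg q)))).
  - intros i e; simpl; tauto.
  - apply pg_neg, sg_and; apply sg_neg; auto.
Qed.

Lemma pg_imp k p q : sg k p -> pg k q -> pg k (fimp p q).
Proof.
  intros. apply (pg_equiv _ (f_or (fneg p) q)); [intros i e; simpl; tauto|].
  apply pg_or; auto using pg_neg.
Qed.

Lemma collection_pg k p i : pg k p -> collection k (St i) -> forall (e : nat -> St i) a,
  (forall x, s_lt _ x a -> exists y, sat _ (scons y (scons x e)) p) ->
  exists b, forall x, s_lt _ x a -> exists y, s_lt _ y b /\ sat _ (scons y (scons x e)) p.
Proof.
  intros [q [Hq E]] Hc e a H. destruct (Hc q Hq e a) as [b Hb].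
  - intros x Hx; destruct (H x Hx) as [y Hy]; exists y; apply E, Hy.
  - exists b; intros x Hx; destruct (Hb x Hx) as [y [Hy Hy']]; exists y; split; auto. apply E, Hy'.
Qed.

Definition bounded_closed (k : nat) : Prop :=
  (forall t p, sg k p -> sg k (fbex t p)) /\ (forall t p, sg k p -> sg k (fball t p)).

Lemma pg_bounded k : bounded_closed k ->
  (forall t p, pg k p -> pg k (fbex t p)) /\ (forall t p, pg k p -> pg k (fball t p)).
Proof.
  intros [H1 H2]; split; intros t p Hp.
  - apply (pg_equiv _ (fneg (fball t (fneg p)))); [|apply pg_neg, H2, sg_neg, Hp].
    intros i e; simpl; split; [|intros [x [Hx Hx']] Hn; exact (Hn x Hx Hx')].
    intros H; apply NNPP; intros H'; apply H; intros x Hx Hx'; apply H'; eauto.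
  - apply (pg_equiv _ (fneg (fbex t (fneg p)))); [|apply pg_neg, H1, sg_neg, Hp].
    intros i e; simpl; split; [|intros Hn [x [Hx Hx']]; auto].
    intros H x Hx; apply NNPP; intros H'; apply H; exists x; auto.
Qed.

Context (HPA : forall i, PAminus (St i)).

(** Two existential quantifiers merge into one by quantifying a common bound of both witnesses; the
    bounded quantifiers this leaves are absorbed into the $\Pi_k$ matrix. *)
Lemma sg_single_quantifier k : bounded_closed k ->
  forall p, sg (S k) p -> exists q, pg k q /\ equiv p (fex q).
Proof.
  intros Hb. destruct (pg_bounded k Hb) as [Hbex _].
  apply sg_succ_ind.
  - intros p q E [r [Hr E']]; exists r; split; auto. intros i e; rewrite <- (E i e); auto.
  - intros p Hp; exists (fsub (shift 1) p); split; [apply pg_fsub, Hp|].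
    intros i e; simpl; split; [intros H; exists (s_zero _)|intros [x H]];
      rewrite sat_fsub in *; auto.
  - intros p Hp [r [Hr E]].
    exists (fbex (tvar 0) (fbex (tvar 1) (fsub (scons (tvar 0) (scons (tvar 1) (shift 3))) r))).
    split; [apply Hbex, Hbex, pg_fsub, Hr|].
    intros i e; simpl; split.
    + intros [y H]; apply E in H as [x H].
      destruct (upper_bound _ (HPA i) x y) as [b [Hx Hy]].
      exists b, y; split; [exact Hy|]. exists x; split; [exact Hx|].
      rewrite sat_fsub, !eval_scons; exact H.
    + intros [b [y [Hy [x [Hx H]]]]]; exists y; apply E; exists x.
      rewrite sat_fsub, !eval_scons in H; exact H.
Qed.

(** At level $k+1$ a bounded existential quantifier commutes with the leading existential one. In
    front of a bounded universal quantifier, collection at level $k$ supplies a common bound $b$ for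
    the witnesses, and $b$ becomes the new leading variable. *)
Lemma collection_bounded_closed k :
  (forall i j, j < k -> collection j (St i)) -> bounded_closed k.
Proof.
  induction k as [|k IH]; intros Hc.
  - split; intros t p Hp; apply sg_0_inv in Hp as [q [Hq E]].
    + apply (sg_equiv _ (fbex t q)); [|apply sg_Delta0; constructor; exact Hq].
      intros i e; simpl; split; intros [x [Hx H]]; exists x; split; auto; apply E, H.
    + apply (sg_equiv _ (fball t q)); [|apply sg_Delta0; constructor; exact Hq].
      intros i e; simpl; split; intros H x Hx; apply E, H, Hx.
  - assert (Hb : bounded_closed k) by (apply IH; intros; apply Hc; lia).
    destruct (pg_bounded k Hb) as [Hbex Hball].
    split; intros t p Hp; destruct (sg_single_quantifier k Hb p Hp) as [r [Hr E]].
    + apply (sg_equiv _ (fex (fbex (tsub (shift 1) t)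
        (fsub (scons (tvar 1) (scons (tvar 0) (shift 2))) r)))).
      * intros i e; simpl; split.
        -- intros [y [x [Hx H]]]; rewrite eval_tsub in Hx; rewrite sat_fsub, !eval_scons in H.
           exists x; split; [exact Hx|]. apply E; exists y; exact H.
        -- intros [x [Hx H]]; apply E in H as [y H]; exists y, x; rewrite eval_tsub; split; [exact Hx|].
           rewrite sat_fsub, !eval_scons; exact H.
      * apply sg_ex, (pg_sg k); auto using pg_fsub.
    + apply (sg_equiv _ (fex (fball (tsub (shift 1) t) (fbex (tvar 1)
        (fsub (scons (tvar 0) (scons (tvar 1) (shift 3))) r))))).
      * intros i e; simpl; split.
        -- intros [b H] x Hx; apply E. rewrite eval_tsub in H; destruct (H x Hx) as [y [Hy Hy']].
           exists y. rewrite sat_fsub, !eval_scons in Hy'; exact Hy'.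
        -- intros H. destruct (collection_pg k r i Hr (Hc i k (le_n _)) e (eval _ e t)) as [b Hb'].
           { intros x Hx; apply E, H, Hx. }
           exists b; rewrite eval_tsub; intros x Hx.
           destruct (Hb' x Hx) as [y [Hy Hy']]; exists y; split; auto.
           rewrite sat_fsub, !eval_scons; exact Hy'.
      * apply sg_ex, (pg_sg k); auto using pg_fsub.
Qed.

End Definability.

Lemma pg_single_quantifier {I} (St : I -> structure) (HPA : forall i, PAminus (St i)) k p :
  bounded_closed St k -> pg St (S k) p -> exists q, sg St k q /\ equiv St p (fall q).
Proof.
  intros Hb Hp.
  destruct (sg_single_quantifier St HPA k Hb _ (sg_neg St _ _ Hp)) as [q [Hq E]].
  exists (fneg q); split; [apply sg_neg, Hq|].
  intros i e; simpl; specialize (E i e); simpl in E; split.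
  - intros H x Hx; apply E; eauto.
  - intros H; apply NNPP; intros H'; apply E in H' as [x Hx]; exact (H x Hx).
Qed.

(** * Least elements, collection and downward search from induction *)

Definition single (M : structure) : unit -> structure := fun _ => M.

Lemma sg_induction {I} (St : I -> structure) i k p :
  ISigma k (St i) -> sg St k p -> induction_instance (St i) p.
Proof.
  intros [_ H] [q [Hq E]] e H0 H1 x. apply E, (H q Hq).
  - apply E, H0.
  - intros y Hy; apply E, H1, E, Hy.
Qed.

Lemma ISigma_le k l M : k <= l -> ISigma l M -> ISigma k M.
Proof. intros H [H0 H1]; split; auto. intros p Hp; apply H1, (Sigma_le k); auto. Qed.

(** Without a least witness, induction on $v$ shows that no $y<v$ satisfies [p]; bounded closure
    makes this statement $\Sigma_k$. *)
Lemma least_element M k p : bounded_closed (single M) k -> ISigma (S k) M ->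
  pg (single M) k p -> forall (e : nat -> M) x, sat M (scons x e) p ->
  exists x, sat M (scons x e) p /\ forall y, s_lt M y x -> ~ sat M (scons y e) p.
Proof.
  intros Hb HI Hp e x Hx; apply NNPP; intros Hno.
  assert (HPA : PAminus M) by apply HI.
  set (T := fball (tvar 0) (fneg (fsub (scons (tvar 0) (shift 2)) p))).
  assert (HT : forall v : M, sat M (scons v e) T <->
    forall y, s_lt M y v -> ~ sat M (scons y e) p).
  { intros v; split; intros H y Hy Hy'; apply (H y Hy);
      [|rewrite sat_fsub, !eval_scons in Hy'; exact Hy'].
    rewrite sat_fsub, !eval_scons; exact Hy'. }
  assert (Hind : induction_instance M T).
  { apply (sg_induction (single M) tt (S k)); [exact HI|].
    apply (sg_le _ k); [lia|]. apply Hb, sg_neg, pg_fsub, Hp. }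
  assert (Hall : forall v : M, sat M (scons v e) T).
  { apply Hind.
    - apply HT; intros y Hy; destruct (not_lt_zero M HPA y Hy).
    - intros v Hv; apply HT; intros y Hy; rewrite HT in Hv.
      apply (lt_succ_iff M HPA) in Hy as [Hy| ->]; [apply Hv, Hy|].
      intros Hp'; apply Hno; eauto. }
  apply Hno; exists x; split; [exact Hx|]. apply HT, Hall.
Qed.

(** Induction on $u$ for the existence of a common bound on witnesses for all $x<u$ with $x<a$.
    Collection at lower levels, known from the strong induction on [j], keeps this statement
    $\Sigma_{j+1}$. *)
Lemma ISigma_collection k M : ISigma (S k) M -> forall j, j <= k -> collection j M.
Proof.
  intros HI0 j; induction j as [j IH] using lt_wf_ind; intros Hj p Hp e a H.
  assert (HI : ISigma (S j) M) by (apply (ISigma_le _ (S k)); auto; lia).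
  assert (HPA : PAminus M) by apply HI.
  assert (Hb : bounded_closed (single M) j).
  { apply collection_bounded_closed; intros; [apply HI|apply IH; lia]. }
  destruct (pg_bounded _ _ Hb) as [Hbex Hball].
  set (T := fex (fball (tvar 1) (fbex (tvar 1)
    (fimp (flt (tvar 1) (tvar 4)) (fsub (scons (tvar 0) (scons (tvar 1) (shift 5))) p))))).
  assert (HT : forall u : M, sat M (scons u (scons a e)) T <-> exists b, forall x, s_lt M x u ->
    exists y, s_lt M y b /\ (s_lt M x a -> sat M (scons y (scons x e)) p)).
  { intros u; split; intros [b Hb']; exists b; intros x Hx;
      destruct (Hb' x Hx) as [y [Hy Hy']]; exists y; split; auto; intros Hxa.
    - specialize (Hy' Hxa). rewrite sat_fsub, !eval_scons in Hy'; exact Hy'.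
    - rewrite sat_fsub, !eval_scons; exact (Hy' Hxa). }
  assert (Hind : induction_instance M T).
  { apply (sg_induction (single M) tt (S j)); [exact HI|].
    apply sg_ex, (pg_sg _ j); [lia|]. apply Hball, Hbex, pg_imp.
    - apply sg_Delta0; constructor.
    - apply pg_fsub, Pi_pg, Hp. }
  assert (Hall : forall u : M, sat M (scons u (scons a e)) T).
  { apply Hind.
    - apply HT; exists (s_zero M); intros y Hy; destruct (not_lt_zero M HPA y Hy).
    - intros u Hu; apply HT in Hu as [b Hu]; apply HT.
      (* For $u\ge a$ the requirement on the witness is void, and zero is a placeholder. *)
      assert (Hy0 : exists y0, s_lt M u a -> sat M (scons y0 (scons u e)) p).
      { destruct (classic (s_lt M u a)) as [Hua|Hua].
        - destruct (H u Hua) as [y Hy]; eauto.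
        - exists (s_zero M); tauto. }
      destruct Hy0 as [y0 Hy0], (upper_bound M HPA b y0) as [b' [Hb1 Hb2]].
      exists b'; intros x Hx; apply (lt_succ_iff M HPA) in Hx as [Hx| ->]; [|eauto].
      destruct (Hu x Hx) as [y [Hy Hy']]; exists y; split; auto.
      exact (lt_trans M HPA _ _ _ Hy Hb1). }
  destruct (proj1 (HT a) (Hall a)) as [b Hb']; exists b; intros x Hx.
  destruct (Hb' x Hx) as [y [Hy Hy']]; eauto.
Qed.

(* Induction on [u] for the statement [P (a - u)], where [a - u] is [a] for [u > a]. *)
Definition reversed (p : form) : form :=
  fex (fand (f_or (feq (tadd (tvar 0) (tvar 1)) (tvar 2))
                  (fand (flt (tvar 2) (tvar 1)) (feq (tvar 0) (tvar 2))))
            (fsub (scons (tvar 0) (shift 3)) p)).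

Lemma sg_reversed {I} (St : I -> structure) k p :
  sg St (S k) p -> sg St (S k) (reversed p).
Proof.
  intros H; apply sg_ex, sg_and; [|apply sg_fsub, H].
  apply sg_Delta0; repeat constructor.
Qed.

(** Without such an $x$, truth of [p] would survive every step down from $a$ and reach $0$. The
    induction instance is taken as a hypothesis, so that the lemma serves full induction in $M$ as
    well as induction in $K$ up to elements of $M$. *)
Lemma reversed_induction M (HPA : PAminus M) p (e : nat -> M) a :
  let T u := sat M (scons u (scons a e)) (reversed p) in
  (T (s_zero M) -> (forall x, T x -> T (s_add M x (s_one M))) -> T a) ->
  sat M (scons a e) p -> ~ sat M (scons (s_zero M) e) p ->
  exists x, s_lt M x a /\ ~ sat M (scons x e) p /\ sat M (scons (s_add M x (s_one M)) e) p.
Proof.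
  intros T HT Ha H0.
  assert (HTE : forall u, T u <-> exists v,
    (s_add M v u = a \/ (s_lt M a u /\ v = a)) /\ sat M (scons v e) p).
  { intros u; split; intros [v [Hv Hv']]; exists v; split; auto.
    - rewrite sat_fsub, !eval_scons in Hv'; exact Hv'.
    - rewrite sat_fsub, !eval_scons; exact Hv'. }
  clearbody T; apply NNPP; intros Hno.
  assert (Hstep : forall x, s_lt M x a -> sat M (scons (s_add M x (s_one M)) e) p ->
    sat M (scons x e) p).
  { intros x Hx Hx'; apply NNPP; intros H; apply Hno; eauto. }
  destruct (proj1 (HTE a)) as [v [[Hv|[Hv _]] Hv']].
  - apply HT.
    + apply HTE; exists a; split; auto. left; apply (add_zero M HPA).
    + intros x Hx; apply HTE in Hx as [v [Hv Hv']]; apply HTE.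
      destruct (classic (s_lt M x a)) as [Hxa|Hxa].
      * destruct Hv as [Hv|[Hv _]]; [|destruct (lt_irrefl M HPA x (lt_trans M HPA _ _ _ Hxa Hv))].
        destruct (pred_exists M HPA v) as [<-|[w ->]].
        { rewrite (add_comm M HPA), (add_zero M HPA) in Hv; subst x.
          destruct (lt_irrefl M HPA _ Hxa). }
        exists w. rewrite (add_succ_l M HPA) in Hv.
        split; [left; exact Hv|].
        apply Hstep; [|exact Hv'].
        rewrite <- Hv. generalize (add_lt M HPA _ _ w (zero_lt_succ M HPA x)).
        rewrite (add_comm M HPA (s_zero M) w), (add_zero M HPA), (add_comm M HPA _ w); auto.
      (* Once $u$ exceeds $a$ the value is reset to $a$, where [p] holds by assumption; this makes
         the induction step valid for every $u$. *)
      * exists a; split; auto. right; split; auto. apply (not_lt M HPA), Hxa.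
  - apply H0. replace (s_zero M) with v; [exact Hv'|].
    apply (add_cancel M HPA) with (w := a).
    rewrite (add_comm M HPA (s_zero M)), (add_zero M HPA); exact Hv.
  - destruct (lt_irrefl M HPA _ Hv).
Qed.

Lemma comp_scons {A B : Type} (f : A -> B) x e :
  (fun j => f (scons x e j)) = scons (f x) (fun j => f (e j)).
Proof. apply functional_extensionality; intros [|j]; reflexivity. Qed.

(** * From end extensions to induction *)

Section EndExtension.
Context (M K : structure) (f : M -> K) (n : nat).
Context (HM : PAminus M) (HK : PAminus K) (Hend : end_extension M K f).
Context (Hel : Sigma_elementary (S (S n)) M K f).

Definition pair_family (b : bool) : structure := if b then M else K.

Lemma pair_PAminus b : PAminus (pair_family b).
Proof. destruct b; assumption. Qed.

Lemma sg_elementary k p : k <= S (S n) -> sg pair_family k p ->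
  forall e : nat -> M, sat M e p <-> sat K (fun j => f (e j)) p.
Proof.
  intros Hk Hp e. apply (sg_le _ _ _ _ Hk) in Hp as [q [Hq E]].
  rewrite (E true e), (E false (fun j => f (e j))). apply Hel, Hq.
Qed.

Lemma pg_elementary k p : k <= S (S n) -> pg pair_family k p ->
  forall e : nat -> M, sat M e p <-> sat K (fun j => f (e j)) p.
Proof.
  intros Hk Hp e. generalize (sg_elementary k _ Hk (sg_neg _ _ _ Hp) e); simpl; tauto.
Qed.

(** Variables outside the support are reset to the image of zero. The remaining ones, whose values
    may lie outside $M$, are existentially quantified one at a time; the formula stays
    $\Sigma_{n+2}$ and ends with parameters from $M$ only. *)
Lemma sg_transfer_down p : sg pair_family (S (S n)) p ->
  forall e : nat -> K, sat K e p -> exists e' : nat -> M, sat M e' p.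
Proof.
  intros Hp e He.
  assert (H : forall N p, sg pair_family (S (S n)) p -> forall e : nat -> K, sat K e p ->
    (forall j, N <= j -> exists m, f m = e j) -> exists e' : nat -> M, sat M e' p).
  { clear p Hp e He. intros N; induction N as [|N IH]; intros p Hp e He Hr.
    - assert (Hc : forall j, {m | f m = e j}).
      { intros j; apply constructive_indefinite_description, Hr; lia. }
      exists (fun j => proj1_sig (Hc j)). apply (sg_elementary _ _ (le_n _) Hp).
      replace (fun j => f (proj1_sig (Hc j))) with e; [exact He|].
      apply functional_extensionality; intros j; symmetry; apply (proj2_sig (Hc j)).
    - destruct (IH (fex p) (sg_ex _ _ _ Hp) (fun j => e (S j))) as [e' [x Hx]].
      + exists (e 0). rewrite scons_eta; exact He.
      + intros j Hj; apply Hr; lia.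
      + eauto. }
  destruct (sat_support K p) as [N HN].
  apply (H N p Hp (fun j => if j <? N then e j else f (s_zero M))).
  - apply (HN e); [|exact He]. intros j Hj. apply Nat.ltb_lt in Hj; rewrite Hj; reflexivity.
  - intros j Hj. apply Nat.ltb_ge in Hj; rewrite Hj; eauto.
Qed.

Lemma f_lt x y : s_lt M x y <-> s_lt K (f x) (f y).
Proof. apply Hend. Qed.

Lemma below_range k m : s_lt K k (f m) -> exists m', f m' = k.
Proof.
  intros H; apply NNPP; intros H'. apply (lt_irrefl K HK k), (lt_trans K HK _ _ _ H).
  apply Hend; intros m' Hm'; apply H'; eauto.
Qed.

Context (d : K) (Hd : forall m, f m <> d).

Lemma range_lt m : s_lt K (f m) d.
Proof. apply Hend, Hd. Qed.

Definition collection_below (k : nat) : Prop :=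
  forall b j, j < k -> collection j (pair_family b).

(** In $K$ the elements below [f a] come from $M$, and [d] exceeds all their witnesses from $M$. So
    the $\Sigma_{k+1}$ statement that a common bound exists holds in $K$, and by elementarity in
    $M$. *)
Lemma collection_base k : k <= S n -> collection_below k -> collection k M.
Proof.
  intros Hk Hc p Hp e a H.
  destruct (pg_bounded _ _ (collection_bounded_closed _ pair_PAminus k Hc)) as [Hbex Hball].
  set (T := fex (fball (tvar 1) (fbex (tvar 1)
    (fsub (scons (tvar 0) (scons (tvar 1) (shift 4))) p)))).
  assert (HT : sat M (scons a e) T).
  { apply (sg_elementary (S k)); [lia|apply sg_ex, (pg_sg _ k); auto using pg_fsub, Pi_pg|].
    rewrite comp_scons. exists d; intros x Hx.
    destruct (below_range _ _ Hx) as [x0 <-]. apply f_lt in Hx.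
    destruct (H _ Hx) as [y Hy]. exists (f y); split; [apply range_lt|].
    rewrite sat_fsub, !eval_scons.
    apply (pg_elementary k) in Hy; [|lia|apply Pi_pg, Hp]. rewrite !comp_scons in Hy; exact Hy. }
  destruct HT as [b Hb]; exists b; intros x Hx. destruct (Hb x Hx) as [y [Hy Hy']].
  exists y; split; auto. rewrite sat_fsub, !eval_scons in Hy'; exact Hy'.
Qed.

(* A failure of the scheme in K, with its parameters quantified out, is a Sigma_{k+3} sentence. *)
Lemma collection_extension k : k < n -> collection_below k -> collection k M -> collection k K.
Proof.
  intros Hk Hc HcM p Hp e a H; apply NNPP; intros Hno.
  destruct (collection_bounded_closed _ pair_PAminus k Hc) as [Hbex Hball].
  set (T1 := fall (fex (fimp (flt (tvar 1) (tvar 2))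
    (fsub (scons (tvar 0) (scons (tvar 1) (shift 3))) p)))).
  set (T2 := fall (fbex (tvar 1) (fball (tvar 1)
    (fneg (fsub (scons (tvar 0) (scons (tvar 1) (shift 4))) p))))).
  destruct (sg_transfer_down (fand T1 T2)) with (e := scons a e) as [e' He'].
  - apply (pg_sg _ (S (S k))); [lia|]. apply pg_and; apply pg_all.
    + apply (sg_pg _ (S k)); [lia|]. apply sg_ex, (pg_sg _ k); [lia|].
      apply pg_imp; [apply sg_Delta0; constructor|apply pg_fsub, Pi_pg, Hp].
    + apply (sg_pg _ k); [lia|]. apply Hbex, Hball, sg_neg, pg_fsub, Pi_pg, Hp.
  - split.
    + intros x. destruct (classic (s_lt K x a)) as [Hx|Hx].
      * destruct (H x Hx) as [y Hy]; exists y; intros _.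
        rewrite sat_fsub, !eval_scons; exact Hy.
      * exists (s_zero K); simpl; tauto.
    + intros b. apply NNPP; intros Hb; apply Hno; exists b; intros x Hx.
      apply NNPP; intros Hy; apply Hb; exists x; split; [exact Hx|].
      intros y Hyb Hy'; rewrite sat_fsub, !eval_scons in Hy'; apply Hy; eauto.
  - rewrite <- (scons_eta e') in He'; destruct He' as [H1 H2].
    destruct (HcM p Hp (fun j => e' (S j)) (e' 0)) as [b Hb].
    + intros x Hx. destruct (H1 x) as [y Hy]; exists y. specialize (Hy Hx).
      rewrite sat_fsub, !eval_scons in Hy; exact Hy.
    + destruct (H2 b) as [x [Hx Hx']]. destruct (Hb x Hx) as [y [Hy Hy']].
      apply (Hx' y Hy). rewrite sat_fsub, !eval_scons; exact Hy'.
Qed.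

(** The two preceding lemmas alternate: $M$ gains a level from the bound [d], then $K$ inherits it.
    Inheritance at level $k$ needs $k+3\le n+2$, so the climb stops at $n$, where $M$ can still gain
    one more level. *)
Lemma collection_below_all k : k <= n -> collection_below k.
Proof.
  induction k as [|k IH]; intros Hk b j Hj; [lia|].
  assert (Hc : collection_below k) by (apply IH; lia).
  destruct (Nat.eq_dec j k) as [->|Hne]; [|apply Hc; lia].
  assert (collection k M) by (apply collection_base; auto; lia).
  destruct b; [assumption|]. apply collection_extension; auto.
Qed.

(* Writing a Sigma_{n+2} formula as [exists y, forall z, sigma], its complement on M is cut out
   in K by the Sigma_{n+1} formula [exists w, forall y < d, exists z < w, ~ sigma]. *)
Lemma end_extension_ISigma : M_ISigma (S n) M K f -> ISigma (S (S n)) M.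
Proof.
  intros HI; split; [exact HM|]. intros p Hp e H0 Hstep a.
  assert (Hc : collection_below n) by (apply collection_below_all; lia).
  assert (HcM : collection n M) by (apply collection_base; auto).
  assert (Hb : bounded_closed pair_family n)
    by (apply collection_bounded_closed; auto; apply pair_PAminus).
  (* The outer quantifier block is normalised in $M$ alone, as collection at level $n$ is known only
     there; the inner block is then normalised in $M$ and $K$ at once. *)
  destruct (sg_single_quantifier (single M) (fun _ => HM) (S n)) with (p := p)
    as [th0 [[th [Hth Eth0]] Eth]].
  { apply collection_bounded_closed; [intros; exact HM|]. intros i j Hj.
    destruct (Nat.eq_dec j n) as [->|Hne]; [exact HcM|apply (Hc true); lia]. }
  { apply Sigma_sg, Hp. }
  destruct (pg_single_quantifier _ pair_PAminus n th Hb (Pi_pg _ _ _ Hth)) as [si [Hsi Esi]].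
  set (Q := fex (fball (tvar 1) (fbex (tvar 1)
    (fneg (fsub (scons (tvar 0) (scons (tvar 1) (shift 4))) si))))).
  assert (HQs : sg pair_family (S n) Q).
  { destruct (pg_bounded _ _ Hb) as [Hbex Hball].
    apply sg_ex, (pg_sg _ n); [lia|]. apply Hball, Hbex, pg_neg, sg_fsub, Hsi. }
  set (g := fun j => f (e j)).
  assert (HQ : forall x, sat K (scons d (scons (f x) g)) Q <-> ~ sat M (scons x e) p).
  { intros x; split.
    - intros [w Hw] Hx. apply (Eth tt) in Hx as [y Hy].
      apply (Eth0 tt), (pg_elementary (S n)) in Hy; [|lia|apply Pi_pg, Hth].
      rewrite !comp_scons in Hy. apply (Esi false) in Hy; simpl in Hy.
      destruct (Hw (f y) (range_lt y)) as [z [_ Hz]]; apply Hz.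
      rewrite sat_fsub, !eval_scons; apply Hy.
    - intros Hx.
      (* In $M$, collection yields a suitable $w$ for every bound $b$. This is a $\Pi_{n+2}$
         statement, so it passes to $K$, where $b$ may be taken to be [d]. *)
      assert (HM' : sat M (scons x e) (fall Q)).
      { intros b. destruct (collection_pg (single M) n (fneg si) tt) with
          (e := scons x e) (a := b) as [w Hw].
        - destruct Hsi as [q [Hq E]]. apply (pg_equiv _ _ (fneg q)).
          + intros i e'; simpl; rewrite (E true); reflexivity.
          + apply pg_neg, Sigma_sg, Hq.
        - exact HcM.
        - intros y _; apply NNPP; intros Hz; apply Hx, (Eth tt). exists y.
          apply (Eth0 tt), (Esi true). intros z; apply NNPP; intros Hz'; apply Hz; exists z; exact Hz'.
        - exists w; intros y Hy. destruct (Hw y Hy) as [z [Hz Hz']]; exists z; split; [exact Hz|].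
          simpl; rewrite sat_fsub, !eval_scons; exact Hz'. }
      apply (pg_elementary (S (S n))) in HM'; [|lia|apply pg_all, (sg_pg _ (S n)); auto].
      rewrite !comp_scons in HM'. exact (HM' d). }
  set (Q' := fsub (scons (tvar 1) (scons (tvar 0) (shift 2))) Q).
  assert (HQ' : forall k, sat K (scons k (scons d g)) Q' <-> sat K (scons d (scons k g)) Q).
  { intros k; unfold Q'; rewrite sat_fsub, !eval_scons; reflexivity. }
  apply NNPP; intros Ha.
  (* [Q'] holds at [f a] and fails at $0$, so it changes value between some $x$ and $x+1$; there [p]
     holds at $x$ but not at $x+1$, against [Hstep]. *)
  destruct (reversed_induction K HK Q' (scons d g) (f a)) as [x [Hx [Hx1 Hx2]]].
  - intros T0 T1.
    destruct (sg_reversed pair_family n Q' (sg_fsub _ _ _ _ HQs)) as [q [Hq E]].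
    specialize (E false); apply E.
    (* Induction up to an element of $M$ concludes strictly below it, so the bound $a+1$ is needed
       to reach $a$. *)
    apply (HI q Hq) with (a := s_add M a (s_one M)).
    + apply E, T0.
    + intros x _ Hx; apply E, T1, E, Hx.
    + apply f_lt, (lt_succ M HM).
  - apply HQ', HQ, Ha.
  - rewrite HQ'. replace (s_zero K) with (f (s_zero M)) by apply Hend.
    rewrite HQ; tauto.
  - destruct (below_range _ _ Hx) as [x0 <-]. rewrite HQ', HQ in Hx1. apply NNPP in Hx1.
    apply HQ' in Hx2. replace (s_add K (f x0) (s_one K)) with (f (s_add M x0 (s_one M))) in Hx2.
    + apply HQ in Hx2; auto.
    + destruct Hend as [[_ [_ [H1 [H2 _]]]] _]. rewrite H2, H1; reflexivity.
Qed.

End EndExtension.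

(** * Generic sequences of definable cofinal sets *)

(** An injective numbering of the syntax, so that all requirements can be met along a sequence of
    length $\omega$. *)
Fixpoint tcode (t : term) : nat :=
  match t with
  | tvar n => to_nat (0, n)
  | tzero => to_nat (1, 0)
  | tone => to_nat (2, 0)
  | tadd a b => to_nat (3, to_nat (tcode a, tcode b))
  | tmul a b => to_nat (4, to_nat (tcode a, tcode b))
  end.

Fixpoint fcode (p : form) : nat :=
  match p with
  | feq a b => to_nat (0, to_nat (tcode a, tcode b))
  | flt a b => to_nat (1, to_nat (tcode a, tcode b))
  | fbot => to_nat (2, 0)
  | fneg q => to_nat (3, fcode q)
  | fand q r => to_nat (4, to_nat (fcode q, fcode r))
  | f_or q r => to_nat (5, to_nat (fcode q, fcode r))
  | fimp q r => to_nat (6, to_nat (fcode q, fcode r))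
  | fall q => to_nat (7, fcode q)
  | fex q => to_nat (8, fcode q)
  | fball t q => to_nat (9, to_nat (tcode t, fcode q))
  | fbex t q => to_nat (10, to_nat (tcode t, fcode q))
  end.

Lemma to_nat_pair a b a' b' : to_nat (a, b) = to_nat (a', b') -> a = a' /\ b = b'.
Proof. intros H; apply to_nat_inj in H; injection H; auto. Qed.

Ltac uncode :=
  repeat match goal with
  | H : to_nat _ = to_nat _ |- _ =>
      let H1 := fresh in let H2 := fresh in apply to_nat_pair in H as [H1 H2]
  end.

Lemma tcode_inj t : forall u, tcode t = tcode u -> t = u.
Proof.
  induction t; intros [] H; cbn [tcode] in H; uncode; try discriminate; f_equal; auto.
Qed.

Lemma fcode_inj p : forall q, fcode p = fcode q -> p = q.
Proof.
  induction p; intros [] H; cbn [fcode] in H; uncode; try discriminate; f_equal;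
    auto using tcode_inj.
Qed.

Section Generic.
Context (M : structure) (n : nat) (HI : ISigma (S (S n)) M).
Context (c : nat -> M) (Hc : forall m, exists k, c k = m).

Let HPA : PAminus M := proj1 HI.

Lemma bounded_closed_base k : k <= S (S n) -> bounded_closed (single M) k.
Proof.
  intros Hk; apply collection_bounded_closed; [intros; exact HPA|].
  intros i j Hj; apply (ISigma_collection (S n) M HI); lia.
Qed.

Definition member (A : form) (i : M) : Prop := sat M (scons i c) A.
Definition related (R : form) (i x : M) : Prop := sat M (scons i (scons x c)) R.
Definition cofinal (A : form) : Prop := forall b, exists i, s_lt M b i /\ member A i.

(* On [A], the length of the initial segment of [[0, a]] on which [R i] holds is constant. *)
Definition decided (A R : form) (a : M) : Prop :=
  (forall i, member A i -> ~ related R i (s_zero M)) \/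
  exists x,
    (forall i, member A i -> forall x', s_lt M x' (s_add M x (s_one M)) -> related R i x') /\
    (x = a \/ (s_lt M x a /\ forall i, member A i -> ~ related R i (s_add M x (s_one M)))).

(* The length is the largest [x <= a] for which [i \in A] with [R i] true on [[0, x]] are
   cofinal; being cofinal is Pi_{n+2}, whence the use of I Sigma_{n+2}. *)
Lemma decide_dense A R a : sg (single M) (S n) A -> cofinal A -> sg (single M) (S n) R ->
  exists A', sg (single M) (S n) A' /\ cofinal A' /\
    (forall i, member A' i -> member A i) /\ decided A' R a.
Proof.
  intros HA Hcof HR.
  destruct (bounded_closed_base (S n)) as [_ Hball]; [lia|].
  set (below i x := forall x', s_lt M x' (s_add M x (s_one M)) -> related R i x').
  (* [N] says of $x$ that the $i$ in [A] with $R(i,\cdot)$ true on $[0,x]$ are bounded in $M$; as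
     the negation of cofinality it is $\Sigma_{n+2}$. *)
  set (N := fex (fneg (fex (fand (flt (tvar 1) (tvar 0))
    (fand (fsub (scons (tvar 0) (shift 3)) A)
       (fball (tadd (tvar 2) tone) (fsub (scons (tvar 1) (scons (tvar 0) (shift 4))) R))))))).
  assert (HNs : sg (single M) (S (S n)) N).
  { apply sg_ex, (pg_sg _ (S n)); [lia|]. apply pg_neg, sg_ex.
    apply sg_and; [apply sg_Delta0; constructor|].
    apply sg_and; [|apply Hball]; apply sg_fsub; assumption. }
  assert (HN : forall x, sat M (scons x c) N <->
    exists b, forall i, s_lt M b i -> member A i -> ~ below i x).
  { intros x; split; intros [b Hb]; exists b.
    - intros i Hi Hi' Hx; apply Hb; exists i; split; [exact Hi|split].
      + rewrite sat_fsub, !eval_scons; exact Hi'.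
      + intros x' Hx'; rewrite sat_fsub, !eval_scons; apply Hx, Hx'.
    - intros [i [Hi [Hi' Hx]]]; rewrite sat_fsub, !eval_scons in Hi'.
      apply (Hb i Hi Hi'). intros x' Hx'. specialize (Hx x' Hx').
      rewrite sat_fsub, !eval_scons in Hx; exact Hx. }
  (* Parameters enter as variables: $x$ and $b$ are the values of [c] at [kx] and [kb], and the
     successor in [S kx] and [S kb] skips the variable for $i$. *)
  assert (Hone : forall x b, exists A', sg (single M) (S n) A' /\
    (forall i, member A' i <-> member A i /\ s_lt M b i /\ below i x)).
  { intros x b; destruct (Hc x) as [kx Hkx], (Hc b) as [kb Hkb].
    exists (fand A (fand (flt (tvar (S kb)) (tvar 0)) (fball (tadd (tvar (S kx)) tone)
      (fsub (scons (tvar 1) (scons (tvar 0) (shift 2))) R)))); split.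
    - apply sg_and; [exact HA|]. apply sg_and; [apply sg_Delta0; constructor|].
      apply Hball, sg_fsub, HR.
    - intros i; unfold member; simpl; rewrite Hkb, Hkx. split.
      + intros [H1 [H2 H3]]; repeat split; auto. intros x' Hx'; specialize (H3 x' Hx').
        rewrite sat_fsub, !eval_scons in H3; exact H3.
      + intros [H1 [H2 H3]]; repeat split; auto. intros x' Hx'.
        rewrite sat_fsub, !eval_scons; apply H3, Hx'. }
  assert (Hcof' : forall x b A', ~ sat M (scons x c) N ->
    (forall i, member A' i <-> member A i /\ s_lt M b i /\ below i x) -> cofinal A').
  { intros x b A' Hx HA' b'. destruct (upper_bound M HPA b b') as [b0 [H1 H2]].
    apply NNPP; intros Hno; apply Hx, HN; exists b0; intros i Hi Hi' Hbel; apply Hno.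
    exists i; split; [exact (lt_trans M HPA _ _ _ H2 Hi)|].
    apply HA'; repeat split; auto. exact (lt_trans M HPA _ _ _ H1 Hi). }
  (* If already the $i$ with $R(i,0)$ are bounded, cutting [A] above the bound makes $R(i,0)$ fail
     throughout. *)
  destruct (classic (sat M (scons (s_zero M) c) N)) as [H0|H0].
  { apply HN in H0 as [b Hb]. destruct (Hc b) as [kb Hkb].
    exists (fand A (flt (tvar (S kb)) (tvar 0))); repeat split.
    - apply sg_and; [exact HA|apply sg_Delta0; constructor].
    - intros b'. destruct (upper_bound M HPA b b') as [b0 [H1 H2]].
      destruct (Hcof b0) as [i [Hi Hi']]; exists i; split; [exact (lt_trans M HPA _ _ _ H2 Hi)|].
      split; [exact Hi'|]. simpl; rewrite Hkb. exact (lt_trans M HPA _ _ _ H1 Hi).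
    - intros i [Hi _]; exact Hi.
    - left. intros i [Hi Hi'] Hr. simpl in Hi'; rewrite Hkb in Hi'. apply (Hb i Hi' Hi).
      intros x' Hx'. apply (lt_succ_iff M HPA) in Hx' as [Hx'| ->]; [|exact Hr].
      destruct (not_lt_zero M HPA _ Hx'). }
  (* If [N] holds at $a$, it becomes true between some $x<a$ and $x+1$: keep the $i$ that work up to
     $x$ and lie beyond the bound for $x+1$. Otherwise the $i$ that work up to $a$ are cofinal and
     can be kept. *)
  destruct (classic (sat M (scons a c) N)) as [Ha|Ha].
  - destruct (reversed_induction M HPA N c a) as [x [Hx [Hx1 Hx2]]]; auto.
    { intros T0 T1. apply (sg_induction (single M) tt _ _ HI (sg_reversed _ _ _ HNs)); auto. }
    apply HN in Hx2 as [b Hb]. destruct (Hone x b) as [A' [HA' HA'i]].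
    exists A'; split; [exact HA'|]. split; [exact (Hcof' x b A' Hx1 HA'i)|].
    split; [intros i Hi; apply HA'i, Hi|]. right; exists x; split.
    + intros i Hi; apply HA'i, Hi.
    + right; split; [exact Hx|]. intros i Hi Hr. apply HA'i in Hi as [H1 [H2 H3]].
      apply (Hb i H2 H1). intros x' Hx'.
      apply (lt_succ_iff M HPA) in Hx' as [Hx'| ->]; auto.
  - destruct (Hone a (s_zero M)) as [A' [HA' HA'i]].
    exists A'; split; [exact HA'|]. split; [exact (Hcof' a _ A' Ha HA'i)|].
    split; [intros i Hi; apply HA'i, Hi|]. right; exists a; split; auto.
    intros i Hi; apply HA'i, Hi.
Qed.

(* [c] enumerates all parameters, so formulas in the fixed environment [c] form a countable
   family of requirements. *)
Lemma generic_sequence : exists A : nat -> form,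
  (forall s, cofinal (A s)) /\
  (forall s i, member (A (S s)) i -> member (A s) i) /\
  (forall R a, sg (single M) (S n) R -> exists s, decided (A s) R a).
Proof.
  set (good A := sg (single M) (S n) A /\ cofinal A).
  assert (Hstep : forall (s : nat) (A : {A | good A}), exists A' : {A | good A},
    (forall i, member (proj1_sig A') i -> member (proj1_sig A) i) /\
    (forall R k, to_nat (fcode R, k) = s -> sg (single M) (S n) R ->
      decided (proj1_sig A') R (c k))).
  { intros s [A [HA1 HA2]]; simpl.
    (* Stage [s] meets the requirement coded by [s], unique by injectivity of the codes, and leaves
       the set unchanged if there is none. *)
    destruct (classic (exists R k, to_nat (fcode R, k) = s /\ sg (single M) (S n) R))
      as [[R [k [HR HR']]]|Hno].
    - destruct (decide_dense A R (c k) HA1 HA2 HR') as [A' [H1 [H2 [H3 H4]]]].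
      exists (exist _ A' (conj H1 H2)); split; [exact H3|]; simpl.
      intros R' k' E _. rewrite <- HR in E. apply to_nat_pair in E as [E ->].
      apply fcode_inj in E as ->; exact H4.
    - exists (exist _ A (conj HA1 HA2)); split; [auto|]. intros R k E HR; exfalso; eauto. }
  assert (H0 : good (feq tzero tzero)).
  { split; [apply sg_Delta0; constructor|]. intros b; exists (s_add M b (s_one M)).
    split; [apply (lt_succ M HPA)|reflexivity]. }
  set (next s A := proj1_sig (constructive_indefinite_description _ (Hstep s A))).
  set (A := fix A s := match s with 0 => exist _ _ H0 | S s => next s (A s) end).
  exists (fun s => proj1_sig (A s)); repeat split.
  - intros s; exact (proj2 (proj2_sig (A s))).
  - intros s; exact (proj1 (proj2_sig (constructive_indefinite_description _ (Hstep s (A s))))).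
  - intros R a HR. destruct (Hc a) as [k <-]. exists (S (to_nat (fcode R, k))).
    apply (proj2 (proj2_sig (constructive_indefinite_description _ (Hstep _ (A _)))));
      auto.
Qed.

(** * Least witnesses and uniformization *)

Definition least (p : form) : form :=
  fand p (fball (tvar 0) (fneg (fsub (scons (tvar 0) (shift 2)) p))).

Lemma sat_least p (e : nat -> M) x : sat M (scons x e) (least p) <->
  sat M (scons x e) p /\ forall y, s_lt M y x -> ~ sat M (scons y e) p.
Proof.
  split; intros [H H']; split; auto; intros y Hy Hy'; apply (H' y Hy);
    rewrite sat_fsub, !eval_scons in *; exact Hy'.
Qed.

Lemma sg_least p : pg (single M) n p -> sg (single M) (S n) (least p).
Proof.
  intros Hp. apply sg_and; [apply (pg_sg _ n); auto|]. apply (sg_le _ n); [lia|].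
  apply bounded_closed_base; [lia|]. apply sg_neg, pg_fsub, Hp.
Qed.

Lemma least_unique p (e : nat -> M) x y :
  sat M (scons x e) (least p) -> sat M (scons y e) (least p) -> x = y.
Proof.
  rewrite !sat_least; intros [H1 H2] [H3 H4].
  destruct (lt_total M HPA x y) as [H|[H|H]]; auto; [destruct (H4 x H H1)|destruct (H2 y H H3)].
Qed.

Lemma least_exists p (e : nat -> M) x : pg (single M) n p -> sat M (scons x e) p ->
  exists y, sat M (scons y e) (least p).
Proof.
  intros Hp Hx. destruct (least_element M n p) with (e := e) (x := x) as [y Hy]; auto.
  - apply bounded_closed_base; lia.
  - apply (ISigma_le _ (S (S n))); auto.
  - exists y; apply sat_least, Hy.
Qed.

(* [R y] is [exists z, pi z y]; take the least [b] bounding some such pair [(z, y)], and then the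
   least [y]. *)
Lemma uniformization R : sg (single M) (S n) R -> exists R', sg (single M) (S n) R' /\
  forall e : nat -> M,
    (forall y, sat M (scons y e) R' -> sat M (scons y e) R) /\
    (forall y y', sat M (scons y e) R' -> sat M (scons y' e) R' -> y = y') /\
    ((exists y, sat M (scons y e) R) -> exists y, sat M (scons y e) R').
Proof.
  intros HR. assert (Hb : bounded_closed (single M) n) by (apply bounded_closed_base; lia).
  destruct (pg_bounded _ _ Hb) as [Hbex _].
  destruct (sg_single_quantifier (single M) (fun _ => HPA) n Hb R HR) as [p [Hp E]].
  set (p' := fsub (scons (tvar 0) (scons (tvar 1) (shift 3))) p).
  (* Since $b$ bounds $z$ as well as $y$, both [B] and [D] are $\Pi_n$, so their least elements
     exist and are $\Sigma_{n+1}$ definable. *)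
  set (B := fbex (tvar 0) (fbex (tvar 1) p')).
  set (D := fand (flt (tvar 0) (tvar 1)) (fbex (tvar 1) p')).
  assert (HD : forall y b (e : nat -> M), sat M (scons y (scons b e)) D <->
    s_lt M y b /\ exists z, s_lt M z b /\ sat M (scons z (scons y e)) p).
  { intros y b e; split.
    - intros [H [z [Hz Hz']]]; unfold p' in Hz'; rewrite sat_fsub, !eval_scons in Hz'.
      split; [exact H|]. exists z; split; [exact Hz|exact Hz'].
    - intros [H [z [Hz Hz']]]; split; [exact H|]. exists z; split; [exact Hz|].
      unfold p'; rewrite sat_fsub, !eval_scons; exact Hz'. }
  assert (HB : forall b (e : nat -> M), sat M (scons b e) B <->
    exists y, sat M (scons y (scons b e)) D).
  { intros b e; split; intros [y Hy]; exists y; exact Hy. }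
  assert (HDs : pg (single M) n D).
  { apply pg_and; [apply pg_Delta0; constructor|]. apply Hbex, pg_fsub, Hp. }
  assert (HBs : pg (single M) n B) by apply Hbex, Hbex, pg_fsub, Hp.
  exists (fex (fand (fsub (scons (tvar 0) (shift 2)) (least B))
    (fsub (scons (tvar 1) (scons (tvar 0) (shift 2))) (least D)))).
  split; [apply sg_ex, sg_and; apply sg_fsub, sg_least; assumption|]. intros e.
  match goal with |- (forall y, sat _ _ ?p -> _) /\ _ => set (R' := p) end.
  assert (HR' : forall y, sat M (scons y e) R' <-> exists b,
    sat M (scons b e) (least B) /\ sat M (scons y (scons b e)) (least D)).
  { intros y; split; intros [b [H1 H2]]; exists b.
    - rewrite sat_fsub, !eval_scons in H1; rewrite sat_fsub, !eval_scons in H2.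
      split; [exact H1|exact H2].
    - split; rewrite sat_fsub, !eval_scons; [exact H1|exact H2]. }
  clearbody R'; repeat split.
  - intros y Hy. apply HR' in Hy as [b [_ Hy]]. apply sat_least in Hy as [Hy _].
    apply HD in Hy as [_ [z [_ Hz]]]. apply (E tt); exists z; exact Hz.
  - intros y y' Hy Hy'. apply HR' in Hy as [b [H1 H2]], Hy' as [b' [H1' H2']].
    rewrite (least_unique B e b b' H1 H1') in H2. exact (least_unique D _ y y' H2 H2').
  - intros [y Hy]. apply (E tt) in Hy as [z Hz].
    destruct (upper_bound M HPA y z) as [b0 [Hb1 Hb2]].
    destruct (least_exists B e b0 HBs) as [b Hb0].
    { apply HB; exists y; apply HD; split; [exact Hb1|]. exists z; split; auto. }
    destruct (proj1 (HB b e)) as [y1 Hy1]; [apply sat_least in Hb0; apply Hb0|].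
    destruct (least_exists D _ y1 HDs Hy1) as [y2 Hy2].
    exists y2; apply HR'; eauto.
Qed.

End Generic.

(** * The restricted ultrapower *)

Section Ultrapower.
Context (M : structure) (n : nat) (HI : ISigma (S (S n)) M).
Context (c : nat -> M) (Hc : forall m, exists k, c k = m).
Context (A : nat -> form).
Context (A_cofinal : forall s, cofinal M c (A s)).
Context (A_decr : forall s i, member M c (A (S s)) i -> member M c (A s) i).
Context (A_decides : forall R a, sg (single M) (S n) R -> exists s, decided M c (A s) R a).

Let HPA : PAminus M := proj1 HI.

(* [P] holds on a set of the ultrafilter generated by the sequence [A]. *)
Definition ev (P : M -> Prop) : Prop := exists s, forall i, member M c (A s) i -> P i.

Lemma A_le s t i : s <= t -> member M c (A t) i -> member M c (A s) i.
Proof. induction 1; auto. Qed.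

Lemma ev_all (P : M -> Prop) : (forall i, P i) -> ev P.
Proof. intros H; exists 0; auto. Qed.

Lemma ev_mp (P Q : M -> Prop) : ev P -> ev (fun i => P i -> Q i) -> ev Q.
Proof.
  intros [s Hs] [t Ht]; exists (s + t); intros i Hi.
  apply Ht; [|apply Hs]; eapply A_le; try exact Hi; lia.
Qed.

Lemma ev_mono (P Q : M -> Prop) : (forall i, P i -> Q i) -> ev P -> ev Q.
Proof. intros H [s Hs]; exists s; auto. Qed.

Lemma ev_and (P Q : M -> Prop) : ev P -> ev Q -> ev (fun i => P i /\ Q i).
Proof. intros H1 H2; apply (ev_mp P); auto; revert H2; apply ev_mono; auto. Qed.

Lemma ev_cofinal (P : M -> Prop) b : ev P -> exists i, s_lt M b i /\ P i.
Proof. intros [s Hs]; destruct (A_cofinal s b) as [i [Hi Hi']]; eauto. Qed.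

(** Sets of the filter are cofinal, hence inhabited: the filter is proper. *)
Lemma ev_const (P : Prop) : ev (fun _ => P) -> P.
Proof. intros H; destruct (ev_cofinal _ (s_zero M) H) as [i [_ Hi]]; exact Hi. Qed.

Lemma ev_not_and (P : M -> Prop) : ev P -> ev (fun i => ~ P i) -> False.
Proof. intros H1 H2; apply ev_const, (ev_mp P); assumption. Qed.

Lemma ev_below (P : nat -> M -> Prop) N :
  (forall j, ev (P j)) -> ev (fun i => forall j, j < N -> P j i).
Proof.
  intros H; induction N as [|N IH].
  - apply ev_all; intros; lia.
  - generalize (ev_and _ _ IH (H N)); apply ev_mono; intros i [H1 H2] j Hj.
    destruct (Nat.eq_dec j N) as [->|]; auto. apply H1; lia.
Qed.

(** Each variable has its own set of agreement; finite support leaves only finitely many of these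
    sets to intersect. *)
Lemma ev_sat_congr p (u v : nat -> M -> M) : (forall j, ev (fun i => u j i = v j i)) ->
  ev (fun i => sat M (fun j => u j i) p) -> ev (fun i => sat M (fun j => v j i) p).
Proof.
  intros H Hu; destruct (sat_support M p) as [N HN].
  apply (ev_mp _ _ Hu). generalize (ev_below _ N H); apply ev_mono.
  intros i Hi; apply HN, Hi.
Qed.

(** * Functions with $\Sigma_{n+1}$ graph on a set of the filter *)

Definition definable_fun (g : M -> M) : Prop := exists G, sg (single M) (S n) G /\
  ev (fun i => forall y, sat M (scons i (scons y c)) G <-> y = g i).

Lemma definable_fun_const m : definable_fun (fun _ => m).
Proof.
  destruct (Hc m) as [k <-]; exists (feq (tvar 1) (tvar (S (S k)))).
  split; [apply sg_Delta0; constructor|]. apply ev_all; intros i y; reflexivity.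
Qed.

Lemma definable_fun_id : definable_fun (fun i => i).
Proof.
  exists (feq (tvar 1) (tvar 0)).
  split; [apply sg_Delta0; constructor|]. apply ev_all; intros i y; reflexivity.
Qed.

(** Interpolates between the functions [u] and the enumeration [c]; [definable_eliminate] removes
    the first [N] entries one at a time. *)
Definition prefix (N : nat) (u v : nat -> M) : nat -> M :=
  fun j => if j <? N then u j else v (j - N).

(** The renaming inserts $z=u_N(i)$ between the first $N$ entries and [c], lengthening the prefix by
    one. *)
Lemma prefix_subst (u : nat -> M -> M) i y z N : z = u N i ->
  let w := prefix N (fun j => u j i) c in
  (fun j => eval M (scons z (scons i (scons y w)))
    (if j <? N then tvar (3 + j) else if j =? N then tvar 0 else tvar (2 + j))) =
  prefix (S N) (fun j => u j i) c.
Proof.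
  intros -> w; apply functional_extensionality; intros j; unfold prefix.
  destruct (lt_eq_lt_dec j N) as [[H| ->]|H].
  - rewrite (proj2 (Nat.ltb_lt j N)), (proj2 (Nat.ltb_lt j (S N))) by lia.
    simpl; unfold w, prefix. rewrite (proj2 (Nat.ltb_lt j N)) by lia; reflexivity.
  - rewrite Nat.ltb_irrefl, Nat.eqb_refl, (proj2 (Nat.ltb_lt N (S N))) by lia. reflexivity.
  - rewrite (proj2 (Nat.ltb_ge j N)), (proj2 (Nat.eqb_neq j N)), (proj2 (Nat.ltb_ge j (S N)))
      by lia.
    destruct j as [|j]; [lia|]. simpl; unfold w, prefix.
    rewrite (proj2 (Nat.ltb_ge j N)) by lia. reflexivity.
Qed.

Lemma prefix_shift (u : nat -> M) x y z N :
  (fun j => eval M (scons x (scons y (scons z (prefix N u c)))) (shift (3 + N) j)) = c.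
Proof.
  apply functional_extensionality; intros j; simpl; unfold prefix.
  rewrite (proj2 (Nat.ltb_ge (N + j) N)) by lia. f_equal; lia.
Qed.

(** The last entry of the prefix is replaced by its $\Sigma_{n+1}$ definition under an existential
    quantifier, which leaves a shorter prefix. *)
Lemma definable_eliminate (u : nat -> M -> M) : (forall j, definable_fun (u j)) ->
  forall N R, sg (single M) (S n) R -> exists T, sg (single M) (S n) T /\
    ev (fun i => forall y, sat M (scons i (scons y c)) T <->
      sat M (scons i (scons y (prefix N (fun j => u j i) c))) R).
Proof.
  intros Hu N; induction N as [|N IH]; intros R HR.
  - exists R; split; [exact HR|]. apply ev_all; intros i y.
    replace (prefix 0 (fun j => u j i) c) with c; [reflexivity|].
    apply functional_extensionality; intros j; unfold prefix; simpl; f_equal; lia.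
  - destruct (Hu N) as [G [HG HGs]].
    destruct (IH (fex (fand
      (fsub (scons (tvar 1) (scons (tvar 0) (shift (3 + N)))) G)
      (fsub (scons (tvar 1) (scons (tvar 2) (fun j =>
        if j <? N then tvar (3 + j) else if j =? N then tvar 0 else tvar (2 + j)))) R))))
      as [T [HT HTs]].
    { apply sg_ex, sg_and; apply sg_fsub; assumption. }
    exists T; split; [exact HT|].
    generalize (ev_and _ _ HGs HTs); apply ev_mono; intros i [H1 H2] y; rewrite H2; clear H2.
    split.
    + intros [z [Hz Hz']]. rewrite sat_fsub, !eval_scons, prefix_shift in Hz.
      apply H1 in Hz. rewrite sat_fsub, !eval_scons, prefix_subst in Hz' by exact Hz. exact Hz'.
    + intros H; exists (u N i); split.
      * rewrite sat_fsub, !eval_scons, prefix_shift. apply H1; reflexivity.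
      * rewrite sat_fsub, !eval_scons, prefix_subst by reflexivity. exact H.
Qed.

(** Brings satisfaction of [p] at definable functions into the form of a relation between $i$ and
    $y$ in the environment [c], the form that the sequence [A] decides. *)
Lemma definable_pullback (u : nat -> M -> M) p : (forall j, definable_fun (u j)) ->
  sg (single M) (S n) p -> exists T, sg (single M) (S n) T /\
    ev (fun i => forall y, sat M (scons i (scons y c)) T <->
      sat M (scons y (fun j => u j i)) p).
Proof.
  intros Hu Hp. destruct (sat_support M p) as [N HN].
  destruct (definable_eliminate u Hu N (fsub (shift 1) p) (sg_fsub _ _ _ _ Hp)) as [T [HT HTs]].
  exists T; split; [exact HT|]. revert HTs; apply ev_mono; intros i H y; rewrite H, sat_fsub.
  assert (E : forall j, j < N -> scons y (prefix N (fun j => u j i) c) j =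
    scons y (fun j => u j i) j).
  { intros [|j] Hj; [reflexivity|]. simpl; unfold prefix.
    rewrite (proj2 (Nat.ltb_lt j N)) by lia; reflexivity. }
  split; apply HN; intros j Hj; [|symmetry]; exact (E j Hj).
Qed.

Lemma definable_fun_term (u : nat -> M -> M) t : (forall j, definable_fun (u j)) ->
  definable_fun (fun i => eval M (fun j => u j i) t).
Proof.
  intros Hu. destruct (definable_pullback u (feq (tvar 0) (tsub (shift 1) t)) Hu)
    as [G [HG HGs]]; [apply sg_Delta0; constructor|].
  exists G; split; [exact HG|]. revert HGs; apply ev_mono; intros i H y.
  rewrite H; simpl; rewrite eval_tsub; reflexivity.
Qed.

(** Uniformization thins the relation between $i$ and $y$ to the graph of a partial function,
    defined on a set of the filter; elsewhere [epsilon] supplies arbitrary values. *)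
Lemma definable_skolem (u : nat -> M -> M) p : (forall j, definable_fun (u j)) ->
  sg (single M) (S n) p -> ev (fun i => exists y, sat M (scons y (fun j => u j i)) p) ->
  exists g, definable_fun g /\ ev (fun i => sat M (scons (g i) (fun j => u j i)) p).
Proof.
  intros Hu Hp Hex. destruct (definable_pullback u p Hu Hp) as [T [HT HTs]].
  set (sw := scons (tvar 1) (scons (tvar 0) (shift 2))).
  assert (Hsw : forall i y q, sat M (scons i (scons y c)) (fsub sw q) <->
    sat M (scons y (scons i c)) q).
  { intros i y q; unfold sw; rewrite sat_fsub, !eval_scons; reflexivity. }
  destruct (uniformization M n HI (fsub sw T) (sg_fsub _ _ _ _ HT)) as [G [HG HG']].
  set (g i := epsilon (inhabits (s_zero M)) (fun y => sat M (scons y (scons i c)) G)).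
  assert (Hg : forall i, (exists y, sat M (scons i (scons y c)) T) ->
    sat M (scons (g i) (scons i c)) G).
  { intros i [y Hy]. apply (epsilon_spec (inhabits (s_zero M))).
    apply HG'; exists y. apply Hsw, Hy. }
  exists g; split.
  - exists (fsub sw G); split; [apply sg_fsub, HG|].
    generalize (ev_and _ _ HTs Hex); apply ev_mono; intros i [H1 [y0 H2]] y; rewrite Hsw.
    apply H1 in H2. split.
    + intros Hy; apply (proj1 (proj2 (HG' (scons i c)))); eauto.
    + intros ->; apply Hg; eauto.
  - generalize (ev_and _ _ HTs Hex); apply ev_mono; intros i [H1 [y0 H2]].
    apply H1, Hsw, HG', Hg. exists y0; apply H1, H2.
Qed.

(** Genericity of [A] in the form used for germs. It yields the ultrafilter property, the constancy
    of bounded germs, and induction up to elements of $M$. *)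
Lemma definable_initial_segment (u : nat -> M -> M) p a : (forall j, definable_fun (u j)) ->
  sg (single M) (S n) p ->
  let holds x i := sat M (scons x (fun j => u j i)) p in
  ev (fun i => ~ holds (s_zero M) i) \/
  exists x, ev (fun i => forall x', s_lt M x' (s_add M x (s_one M)) -> holds x' i) /\
    (x = a \/ (s_lt M x a /\ ev (fun i => ~ holds (s_add M x (s_one M)) i))).
Proof.
  intros Hu Hp holds. destruct (definable_pullback u p Hu Hp) as [T [HT HTs]].
  destruct (A_decides T a HT) as [s [H|[x [H1 H2]]]].
  - left. apply (ev_mp _ _ (ex_intro _ s H : ev _)). revert HTs; apply ev_mono.
    intros i Hi Hn Hh; apply Hn, Hi, Hh.
  - right; exists x; split.
    + apply (ev_mp _ _ (ex_intro _ s H1 : ev _)). revert HTs; apply ev_mono.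
      intros i Hi Hn x' Hx'; apply Hi, Hn, Hx'.
    + destruct H2 as [H2|[H2 H3]]; [left; exact H2|right; split; [exact H2|]].
      apply (ev_mp _ _ (ex_intro _ s H3 : ev _)). revert HTs; apply ev_mono.
      intros i Hi Hn Hh; apply Hn, Hi, Hh.
Qed.

(** A formula in which the distinguished variable is a dummy either fails at $0$ or holds on an
    initial segment containing $0$; for $\Pi_{n+1}$ formulas the negation is decided. *)
Lemma ev_decide (u : nat -> M -> M) p : (forall j, definable_fun (u j)) ->
  sg (single M) (S n) p \/ pg (single M) (S n) p ->
  ev (fun i => sat M (fun j => u j i) p) \/ ev (fun i => ~ sat M (fun j => u j i) p).
Proof.
  intros Hu.
  assert (H : forall p, sg (single M) (S n) p ->
    ev (fun i => sat M (fun j => u j i) p) \/ ev (fun i => ~ sat M (fun j => u j i) p)).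
  { clear p; intros p Hp.
    destruct (definable_initial_segment u (fsub (shift 1) p) (s_zero M) Hu (sg_fsub _ _ _ _ Hp))
      as [H|[x [H _]]]; [right|left]; revert H; apply ev_mono; intros i H.
    - intros H'; apply H. rewrite sat_fsub; exact H'.
    - specialize (H (s_zero M) (zero_lt_succ M HPA x)). rewrite sat_fsub in H; exact H. }
  intros [Hp|Hp]; [apply H, Hp|].
  destruct (H (fneg p) (sg_neg _ _ _ Hp)) as [H'|H']; [right; exact H'|left].
  revert H'; apply ev_mono; intros i; apply NNPP.
Qed.

(** * Germs and the structure on them *)

Definition fun_inh : inhabited (M -> M) := inhabits (fun i => i).

(* A choice of representatives modulo [ev]-equality, in place of a quotient type. *)
Definition rep (g : M -> M) : M -> M :=
  epsilon fun_inh (fun h => definable_fun h /\ ev (fun i => h i = g i)).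

Lemma rep_spec g : definable_fun g -> definable_fun (rep g) /\ ev (fun i => rep g i = g i).
Proof.
  intros Hg; unfold rep; apply (epsilon_spec fun_inh).
  exists g; split; auto. apply ev_all; reflexivity.
Qed.

(** Functions that agree on a set of the filter give equal defining predicates, and [epsilon]
    depends on the predicate alone. *)
Lemma rep_congr g h : ev (fun i => g i = h i) -> rep g = rep h.
Proof.
  intros H; unfold rep; f_equal. apply functional_extensionality; intros k.
  apply propositional_extensionality; split; intros [H1 H2]; split; auto.
  - generalize (ev_and _ _ H H2); apply ev_mono; intros i [<- E]; exact E.
  - generalize (ev_and _ _ H H2); apply ev_mono; intros i [-> E]; exact E.
Qed.

Definition germ : Type := {g : M -> M | definable_fun g /\ rep g = g}.

Definition val (k : germ) : M -> M := proj1_sig k.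

Lemma val_definable k : definable_fun (val k).
Proof. exact (proj1 (proj2_sig k)). Qed.

Definition cls (g : M -> M) (Hg : definable_fun g) : germ :=
  exist _ (rep g) (conj (proj1 (rep_spec g Hg)) (rep_congr _ _ (proj2 (rep_spec g Hg)))).

Lemma val_cls g Hg : ev (fun i => val (cls g Hg) i = g i).
Proof. exact (proj2 (rep_spec g Hg)). Qed.

Lemma germ_eq k l : ev (fun i => val k i = val l i) -> k = l.
Proof.
  destruct k as [g [Hg Eg]], l as [h [Hh Eh]]; simpl; intros H.
  apply rep_congr in H. assert (g = h) as -> by congruence.
  f_equal; apply proof_irrelevance.
Qed.

Definition germ_term (u : nat -> germ) (t : term) : germ :=
  cls _ (definable_fun_term (fun j => val (u j)) t (fun j => val_definable (u j))).

Definition ultrapower : structure := {|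
  dom := germ;
  s_zero := cls _ (definable_fun_const (s_zero M));
  s_one := cls _ (definable_fun_const (s_one M));
  s_add := fun k l => germ_term (scons k (fun _ => l)) (tadd (tvar 0) (tvar 1));
  s_mul := fun k l => germ_term (scons k (fun _ => l)) (tmul (tvar 0) (tvar 1));
  s_lt := fun k l => ev (fun i => s_lt M (val k i) (val l i)) |}.

Let K := ultrapower.

Definition at_ (e : nat -> K) (i : M) : nat -> M := fun j => val (e j) i.

Lemma at_scons k e i : at_ (scons k e) i = scons (val k i) (at_ e i).
Proof. apply functional_extensionality; intros [|j]; reflexivity. Qed.

Lemma eval_ultrapower (e : nat -> K) t :
  ev (fun i => val (eval K e t) i = eval M (at_ e i) t).
Proof.
  induction t as [j| | |a IHa b IHb|a IHa b IHb].
  - apply ev_all; reflexivity.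
  - apply val_cls.
  - apply val_cls.
  - refine (ev_mp _ _ (ev_and _ _ IHa IHb) (ev_mono _ _ _ (val_cls _ _))).
    intros i H [E1 E2]; exact (eq_trans H (f_equal2 (s_add M) E1 E2)).
  - refine (ev_mp _ _ (ev_and _ _ IHa IHb) (ev_mono _ _ _ (val_cls _ _))).
    intros i H [E1 E2]; exact (eq_trans H (f_equal2 (s_mul M) E1 E2)).
Qed.

(** * Los' theorem up to level $n+1$ *)

Definition los (p : form) : Prop :=
  forall e : nat -> K, sat K e p <-> ev (fun i => sat M (at_ e i) p).

Lemma los_equiv p q :
  (forall (N : structure) (e : nat -> N), sat N e p <-> sat N e q) -> los p -> los q.
Proof.
  intros E Hp e. rewrite <- (E K), (Hp e).
  split; apply ev_mono; intros i; apply E.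
Qed.

Lemma los_eq a b : los (feq a b).
Proof.
  intros e; generalize (ev_and _ _ (eval_ultrapower e a) (eval_ultrapower e b)); intros H.
  split; intros H'; simpl in H' |- *.
  - revert H; apply ev_mono; intros i [<- <-]; rewrite H'; reflexivity.
  - apply germ_eq. generalize (ev_and _ _ H H'); apply ev_mono; intros i [[-> ->] E]; exact E.
Qed.

Lemma los_lt a b : los (flt a b).
Proof.
  intros e; generalize (ev_and _ _ (eval_ultrapower e a) (eval_ultrapower e b)); intros H.
  split; intros H'; simpl in H' |- *;
    generalize (ev_and _ _ H H'); apply ev_mono; intros i [[E1 E2] E];
    rewrite ?E1, ?E2 in *; exact E.
Qed.

Lemma los_bot : los fbot.
Proof. intros e; split; [intros []|]. exact (ev_const False). Qed.

(** This is where the filter must act as an ultrafilter, which is known for $\Sigma_{n+1}$ and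
    $\Pi_{n+1}$ formulas. *)
Lemma los_neg p : sg (single M) (S n) p \/ pg (single M) (S n) p -> los p -> los (fneg p).
Proof.
  intros Hp H e; simpl; rewrite (H e); split.
  - intros Hn. destruct (ev_decide (fun j => val (e j)) p (fun j => val_definable _) Hp); tauto.
  - intros H1 H2; exact (ev_not_and _ H2 H1).
Qed.

Lemma los_and p q : los p -> los q -> los (fand p q).
Proof.
  intros Hp Hq e; simpl; rewrite (Hp e), (Hq e); split.
  - intros [H1 H2]; apply ev_and; assumption.
  - intros H; split; revert H; apply ev_mono; tauto.
Qed.

(** Witnesses at the single indices are collected into one germ by definable choice. *)
Lemma los_ex p : sg (single M) (S n) p -> los p -> los (fex p).
Proof.
  intros Hp H e; split.
  - intros [k Hk]; apply H in Hk; revert Hk; apply ev_mono; intros i Hi.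
    rewrite at_scons in Hi; exists (val k i); exact Hi.
  - intros Hex.
    destruct (definable_skolem (fun j => val (e j)) p (fun j => val_definable _) Hp Hex)
      as [g [Hg Hg']].
    exists (cls g Hg); apply H. generalize (ev_and _ _ (val_cls g Hg) Hg').
    apply ev_mono; intros i [E Hi]; rewrite at_scons, E; exact Hi.
Qed.

Lemma los_bex t p : sg (single M) (S n) p -> los p -> los (fbex t p).
Proof.
  intros Hp H. apply (los_equiv (fex (fand (flt (tvar 0) (tsub (shift 1) t)) p))).
  - intros N e; simpl; split; intros [x Hx]; exists x; rewrite eval_tsub in *; exact Hx.
  - apply los_ex; [|apply los_and; [apply los_lt|exact H]].
    apply sg_and; [apply sg_Delta0; constructor|exact Hp].
Qed.

Lemma los_Delta0 p : Delta0 p -> los p.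
Proof.
  assert (HD : forall q, Delta0 q -> sg (single M) (S n) q) by (intros; apply sg_Delta0; auto).
  induction 1.
  - apply los_eq.
  - apply los_lt.
  - apply los_bot.
  - apply los_neg; auto.
  - apply los_and; auto.
  - apply (los_equiv (fneg (fand (fneg p) (fneg q)))); [intros N e; simpl; tauto|].
    apply los_neg; [left; apply HD; repeat constructor; assumption|].
    apply los_and; apply los_neg; auto.
  - apply (los_equiv (fneg (fand p (fneg q)))); [intros N e; simpl; tauto|].
    apply los_neg; [left; apply HD; repeat constructor; assumption|].
    apply los_and; [|apply los_neg]; auto.
  - apply (los_equiv (fneg (fbex t (fneg p)))).
    + intros N e; simpl; split; [|intros H' [x [Hx Hx']]; auto].
      intros Hn x Hx; apply NNPP; intros Hx'; eauto.
    + apply los_neg; [left; apply HD; repeat constructor; assumption|].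
      apply los_bex; [apply HD; constructor; assumption|]. apply los_neg; auto.
  - apply los_bex; auto.
Qed.

Lemma los_Sigma_Pi :
  (forall k p, Sigma k p -> k <= S n -> los p) /\ (forall k p, Pi k p -> k <= S n -> los p).
Proof.
  apply Sigma_Pi_ind; intros.
  - apply los_Delta0; assumption.
  - apply H0; lia.
  - apply los_ex; auto. apply (sg_le _ (S k)); auto using Sigma_sg.
  - apply los_Delta0; assumption.
  - apply H0; lia.
  - apply (los_equiv (fneg (fex (fneg p)))).
    + intros N e; simpl; split; [|intros H' [x Hx]; auto].
      intros Hn x; apply NNPP; eauto.
    + assert (Hp : pg (single M) (S n) p) by (apply (pg_le _ (S k)); auto using Pi_pg).
      apply los_neg; [left; apply sg_ex, sg_neg, Hp|].
      apply los_ex; [apply sg_neg, Hp|]. apply los_neg; auto.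
Qed.

Lemma los_valid p : los p -> (forall e : nat -> M, sat M e p) -> forall e : nat -> K, sat K e p.
Proof. intros H Hv e; apply H, ev_all; intros i; apply Hv. Qed.

(** * The canonical embedding and the properties of the ultrapower *)

Definition emb (m : M) : K := cls _ (definable_fun_const m).

Lemma val_emb m : ev (fun i => val (emb m) i = m).
Proof. apply val_cls. Qed.

Lemma at_congr p (e : nat -> K) (u : nat -> M -> M) :
  (forall j, ev (fun i => val (e j) i = u j i)) ->
  (ev (fun i => sat M (at_ e i) p) <-> ev (fun i => sat M (fun j => u j i) p)).
Proof.
  intros H; split; apply (ev_sat_congr p).
  - exact H.
  - intros j; generalize (H j); apply ev_mono; auto.
Qed.

Lemma at_emb p (e : nat -> M) :
  ev (fun i => sat M (at_ (fun j => emb (e j)) i) p) <-> sat M e p.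
Proof.
  rewrite (at_congr p _ (fun j _ => e j)); [|intros j; apply val_emb].
  split; [apply ev_const|intros H; apply ev_all; auto].
Qed.

Lemma at_scons_emb p k (e : nat -> M) :
  ev (fun i => sat M (at_ (scons k (fun j => emb (e j))) i) p) <->
  ev (fun i => sat M (scons (val k i) e) p).
Proof.
  rewrite (at_congr p _ (scons (val k) (fun j _ => e j))).
  - split; apply ev_mono; intros i H.
    + replace (scons (val k i) e) with (fun j => scons (val k) (fun j _ => e j) j i); [exact H|].
      apply functional_extensionality; intros [|j]; reflexivity.
    + replace (fun j => scons (val k) (fun j _ => e j) j i) with (scons (val k i) e); [exact H|].
      apply functional_extensionality; intros [|j]; reflexivity.
  - intros [|j]; [apply ev_all; reflexivity|exact (val_emb (e j))].
Qed.

Definition env3 (x y w : K) : nat -> K := scons x (scons y (fun _ => w)).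

(** Apart from the existence of differences, the axioms are open formulas in at most three variables
    and hold for germs because they hold at every index. A difference is a witness supplied by
    [los_ex]. *)
Lemma ultrapower_PAminus : PAminus K.
Proof.
  assert (V : forall p, Delta0 p -> (forall x y w : M, sat M (scons x (scons y (fun _ => w))) p) ->
    forall x y w : K, sat K (env3 x y w) p).
  { intros p Hp Hv x y w; apply los_Delta0; [exact Hp|]. apply ev_all; intros i.
    unfold env3; rewrite !at_scons; apply Hv. }
  pose (X := tvar 0); pose (Y := tvar 1); pose (W := tvar 2).
  assert (H := HPA); unfold PAminus in H; cbv zeta in H.
  destruct H as (H1&H2&H3&H4&H5&H6&H7&H8&H9&H10&H11&H12&H13&H14&H15&H16&H17).
  repeat split.
  - intros x y; apply (V (feq (tadd X Y) (tadd Y X))) with (w := x); [constructor|].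
    intros; apply H1.
  - intros x y w; apply (V (feq (tadd (tadd X Y) W) (tadd X (tadd Y W)))) with (w := w);
      [constructor|]. intros; apply H2.
  - intros x y; apply (V (feq (tmul X Y) (tmul Y X))) with (w := x); [constructor|].
    intros; apply H3.
  - intros x y w; apply (V (feq (tmul (tmul X Y) W) (tmul X (tmul Y W)))) with (w := w);
      [constructor|]. intros; apply H4.
  - intros x y w; apply (V (feq (tmul X (tadd Y W)) (tadd (tmul X Y) (tmul X W)))) with (w := w);
      [constructor|]. intros; apply H5.
  - intros x; apply (V (feq (tadd X tzero) X)) with (y := x) (w := x); [constructor|].
    intros; apply H6.
  - intros x; apply (V (feq (tmul X tzero) tzero)) with (y := x) (w := x); [constructor|].
    intros; apply H7.
  - intros x; apply (V (feq (tmul X tone) X)) with (y := x) (w := x); [constructor|].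
    intros; apply H8.
  - intros x; apply (V (fneg (flt X X))) with (y := x) (w := x); [repeat constructor|].
    intros; apply H9.
  - intros x y w; apply (V (fimp (flt X Y) (fimp (flt Y W) (flt X W)))); [repeat constructor|].
    intros a b d; exact (H10 a b d).
  - intros x y; apply (V (f_or (flt X Y) (f_or (feq X Y) (flt Y X)))) with (w := x);
      [repeat constructor|]. intros; apply H11.
  - intros x y w; apply (V (fimp (flt X Y) (flt (tadd X W) (tadd Y W)))); [repeat constructor|].
    intros a b d; exact (H12 a b d).
  - intros x y w; apply (V (fimp (flt tzero W) (fimp (flt X Y) (flt (tmul X W) (tmul Y W)))));
      [repeat constructor|]. intros a b d; exact (H13 a b d).
  - intros x y Hxy.
    assert (L : los (fex (feq (tadd Y X) W))).
    { apply los_ex; [apply sg_Delta0; constructor|apply los_eq]. }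
    apply (L (env3 x y y)). revert Hxy; apply ev_mono; intros i; apply H14.
  - apply ev_mono with (P := fun i => s_lt M (s_zero M) (s_one M)
      /\ val (emb (s_zero M)) i = s_zero M /\ val (emb (s_one M)) i = s_one M).
    + intros i [H [E1 E2]]; change (s_lt M (val (emb (s_zero M)) i) (val (emb (s_one M)) i)).
      rewrite E1, E2; exact H.
    + apply ev_and; [apply ev_all; auto|apply ev_and; apply val_emb].
  - intros x; apply (V (fimp (flt tzero X) (f_or (feq tone X) (flt tone X))))
      with (y := x) (w := x); [repeat constructor|]. intros a b d; exact (H16 a).
  - intros x; apply (V (f_or (feq tzero X) (flt tzero X))) with (y := x) (w := x);
      [repeat constructor|]. intros; apply H17.
Qed.

(* The least number principle below [b] is a Delta_0 formula valid in M. *)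
Lemma ultrapower_IDelta0 : IDelta0 K.
Proof.
  split; [apply ultrapower_PAminus|]. intros p Hp e H0 Hstep b; apply NNPP; intros Hb.
  set (p' := fsub (scons (tvar 0) (shift 2)) p).
  set (p1 := fsub (scons (tadd (tvar 0) tone) (shift 2)) p).
  set (T := fimp (fand (fsub (scons tzero (shift 1)) p) (fneg p))
    (fbex (tvar 0) (fand p' (fneg p1)))).
  assert (HT : Delta0 T) by (repeat (assumption || apply Delta0_fsub || constructor)).
  destruct (los_valid T (los_Delta0 T HT)) with (e := scons b e) as [x [_ [Hx Hx1]]].
  - intros v; rewrite <- (scons_eta v).
    generalize (v 0) (fun j => v (S j)); clear v; intros w u [Hv0 Hvx].
    (* In $M$ the last point before [p] fails is found by searching down from $w$ with the negation
       of [p]. *)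
    destruct (reversed_induction M HPA (fneg p) u w) as [x [Hx [H1 H2]]].
    + intros T0 T1. apply (sg_induction (single M) tt (S n)); auto.
      * apply (ISigma_le _ (S (S n))); auto.
      * apply sg_reversed, sg_Delta0; constructor; exact Hp.
    + exact Hvx.
    + intros H; apply H. rewrite sat_fsub, !eval_scons in Hv0; exact Hv0.
    + exists x; split; [exact Hx|]; split.
      * apply NNPP in H1. unfold p'; rewrite sat_fsub, !eval_scons; exact H1.
      * intros H; apply H2. unfold p1 in H; rewrite sat_fsub, !eval_scons in H; exact H.
  - split; [|exact Hb]. rewrite sat_fsub, !eval_scons; exact H0.
  - apply Hx1. unfold p1; unfold p' in Hx; rewrite sat_fsub, !eval_scons in Hx |- *.
    apply Hstep, Hx.
Qed.

(** Los' theorem is applied to the equation of the shifted term with a fresh variable that carries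
    its value. *)
Lemma emb_term (e : nat -> M) t : emb (eval M e t) = eval K (fun j => emb (e j)) t.
Proof.
  apply germ_eq.
  generalize (proj2 (at_emb (feq (tsub (fun j => tvar (S j)) t) (tvar 0)) (scons (eval M e t) e)));
    intros H.
  assert (H' : sat K (fun j => emb (scons (eval M e t) e j))
    (feq (tsub (fun j => tvar (S j)) t) (tvar 0))).
  { apply los_eq, H. simpl; rewrite eval_tsub; reflexivity. }
  simpl in H'; rewrite eval_tsub in H'; simpl in H'; rewrite H'.
  apply ev_all; reflexivity.
Qed.

(** The same formula works in $K$ with its parameters embedded: recursion and uniqueness are
    $\Delta_0$ and hold at every index, and totality is Los' theorem for one existential
    quantifier. *)
Lemma ultrapower_exp : Exp_axiom M -> Exp_axiom K.
Proof.
  intros [p [e [Hp [E0 [E1 [E2 E3]]]]]].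
  exists p, (fun j => emb (e j)); split; [exact Hp|].
  assert (L : forall q, Delta0 q -> (forall x y y' : M, sat M (scons x (scons y (scons y' e))) q) ->
    forall x y y' : K, sat K (scons x (scons y (scons y' (fun j => emb (e j))))) q).
  { intros q Hq Hv x y y'; apply los_Delta0; [exact Hq|].
    apply (at_congr q _ (scons (val x) (scons (val y) (scons (val y') (fun j _ => e j))))).
    - intros [|[|[|j]]]; try (apply ev_all; reflexivity). exact (val_emb (e j)).
    - apply ev_all; intros i. generalize (Hv (val x i) (val y i) (val y' i)).
      match goal with |- sat M ?u q -> sat M ?v q => replace v with u; auto end.
      apply functional_extensionality; intros [|[|[|j]]]; reflexivity. }
  repeat split.
  - generalize (proj2 (at_emb p (scons (s_zero M) (scons (s_one M) e))) E0); intros H.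
    apply los_Delta0 in H; [|exact Hp]. rewrite !comp_scons in H; exact H.
  - intros x y Hxy.
    generalize (L (fimp (fsub (scons (tvar 0) (scons (tvar 1) (shift 3))) p)
      (fsub (scons (tadd (tvar 0) tone) (scons (tadd (tvar 1) (tvar 1)) (shift 3))) p))); intros H.
    specialize (fun H1 H2 => H H1 H2 x y y); simpl in H.
    rewrite !sat_fsub, !eval_scons in H. apply H; auto.
    + repeat (constructor || apply Delta0_fsub || assumption).
    + intros a b d; simpl; rewrite !sat_fsub, !eval_scons; apply E1.
  - intros x y y' H1 H2.
    generalize (L (fimp (fand (fsub (scons (tvar 0) (scons (tvar 1) (shift 3))) p)
      (fsub (scons (tvar 0) (scons (tvar 2) (shift 3))) p)) (feq (tvar 1) (tvar 2)))); intros H.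
    specialize (fun H1 H2 => H H1 H2 x y y'); simpl in H.
    rewrite !sat_fsub, !eval_scons in H. apply H; auto.
    + repeat (constructor || apply Delta0_fsub || assumption).
    + intros a b b'; simpl; rewrite !sat_fsub, !eval_scons; intros [H3 H4]; exact (E2 a b b' H3 H4).
  - intros x. set (q := fsub (scons (tvar 1) (scons (tvar 0) (shift 2))) p).
    assert (Hq : Delta0 q) by apply Delta0_fsub, Hp.
    assert (HL : los (fex q)).
    { apply los_ex; [apply sg_Delta0, Hq|apply los_Delta0, Hq]. }
    destruct (proj2 (HL (scons x (fun j => emb (e j))))) as [y Hy].
    + apply at_scons_emb, ev_all; intros i. destruct (E3 (val x i)) as [y Hy]; exists y.
      unfold q; rewrite sat_fsub, !eval_scons; exact Hy.
    + exists y. unfold q in Hy; rewrite sat_fsub, !eval_scons in Hy; exact Hy.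
Qed.

Lemma emb_lt x y : s_lt M x y <-> s_lt K (emb x) (emb y).
Proof.
  generalize (los_lt (tvar 0) (tvar 1) (fun j => emb (scons x (scons y (fun _ => y)) j))).
  rewrite at_emb; simpl; intros ->; reflexivity.
Qed.

Lemma ultrapower_embedding : embedding M K emb.
Proof.
  repeat split.
  - intros x y H. apply ev_const.
    generalize (ev_and _ _ (val_emb x) (val_emb y)); apply ev_mono; intros i [<- <-].
    rewrite H; reflexivity.
  - intros x y; apply (emb_term (scons x (fun _ => y)) (tadd (tvar 0) (tvar 1))).
  - intros x y; apply (emb_term (scons x (fun _ => y)) (tmul (tvar 0) (tvar 1))).
  - apply emb_lt.
  - apply emb_lt.
Qed.

(** A germ $k$ not above $m$ is constant: the set of $x\le m$ with $x\le k(i)$ is decided on a set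
    of the filter, and its maximum is the value of $k$ there. *)
Lemma ultrapower_end : end_extension M K emb.
Proof.
  split; [apply ultrapower_embedding|]. intros k Hk m.
  assert (HK := ultrapower_PAminus).
  destruct (lt_total K HK (emb m) k) as [H|[H|H]]; [exact H|destruct (Hk _ H)|].
  (* The formula says $x\le k(i)$, written as $x<k(i)+1$. *)
  exfalso. set (p := flt (tvar 0) (tadd (tvar 1) tone)).
  assert (Hp : forall x y, sat M (scons x (fun _ => y)) p <-> s_lt M x y \/ x = y).
  { intros x y; apply (lt_succ_iff M HPA). }
  destruct (definable_initial_segment (fun _ => val k) p m (fun _ => val_definable k))
    as [H0|[x [Hx1 Hx2]]].
  - apply sg_Delta0; constructor.
  - apply ev_const; revert H0; apply ev_mono; intros i Hi; apply Hi, Hp.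
    destruct (zero_le M HPA (val k i)); auto.
  - destruct Hx2 as [->|[_ Hx2]].
    + apply ev_const; generalize (ev_and _ _ H (ev_and _ _ Hx1 (val_emb m))).
      apply ev_mono; intros i [H1 [H2 H3]]; rewrite H3 in H1.
      specialize (H2 m (lt_succ M HPA m)); apply Hp in H2 as [H2| ->].
      * exact (lt_irrefl M HPA _ (lt_trans M HPA _ _ _ H1 H2)).
      * exact (lt_irrefl M HPA _ H1).
    + apply (Hk x), germ_eq. generalize (ev_and _ _ Hx2 (ev_and _ _ Hx1 (val_emb x))).
      apply ev_mono; intros i [H1 [H2 ->]].
      specialize (H2 x (lt_succ M HPA x)); apply Hp in H2 as [H2|H2]; [|exact H2].
      destruct H1; apply Hp. destruct (succ_le M HPA _ _ H2); auto.
Qed.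

(** The germ of the identity differs from every constant $m$, since each set of the filter has
    elements above $m$. *)
Lemma ultrapower_proper : proper M K emb.
Proof.
  exists (cls _ definable_fun_id); intros m Hm.
  destruct (ev_cofinal (fun i => i = m) m) as [i [Hi ->]].
  - generalize (ev_and _ _ (val_cls _ definable_fun_id) (val_emb m)); apply ev_mono.
    intros i [H1 H2]; rewrite Hm in H2; rewrite <- H1; exact H2.
  - exact (lt_irrefl M HPA _ Hi).
Qed.

(** Los' theorem covers the $\Pi_{n+1}$ matrix, and the leading existential block is added by hand.
    Downwards the claim is generalised to all environments of germs, because witnesses in $K$ may
    lie outside $M$. *)
Lemma ultrapower_elementary : Sigma_elementary (S (S n)) M K emb.
Proof.
  intros p Hp e; split.
  - revert e; apply (Sigma_succ_ind (S n)) with (p := p); auto; clear p Hp.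
    + intros p Hp e H; apply (proj2 los_Sigma_Pi _ _ Hp); auto. apply at_emb, H.
    + intros p Hp IH e [x Hx]; exists (emb x). rewrite <- comp_scons; apply IH, Hx.
  - intros H; apply at_emb. revert H; generalize (fun j => emb (e j)).
    apply (Sigma_succ_ind (S n)) with (p := p); auto; clear p Hp.
    + intros p Hp u H; apply (proj2 los_Sigma_Pi _ _ Hp); auto.
    + intros p Hp IH u [k Hk]; apply IH in Hk; revert Hk; apply ev_mono; intros i Hi.
      rewrite at_scons in Hi; exists (val k i); exact Hi.
Qed.

(** Elements of $K$ below [emb a] are constants, so the initial segment of $[0,a]$ on which [p]
    holds is decided. If it stopped at some $x<a$, the induction step would fail at $x$. *)
Lemma ultrapower_M_ISigma : M_ISigma (S n) M K emb.
Proof.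
  intros p Hp e a H0 Hstep k Hk.
  assert (L : los p) by (apply (proj1 los_Sigma_Pi _ _ Hp); auto).
  assert (Lx : forall (k : K) x (Hx : ev (fun i => val k i = x)), sat K (scons k e) p <->
    ev (fun i => sat M (scons x (fun j => val (e j) i)) p)).
  { intros l x Hx; rewrite (L (scons l e)).
    split; intros H; generalize (ev_and _ _ Hx H); apply ev_mono; intros i [E Hi];
      rewrite at_scons, E in *; exact Hi. }
  destruct (definable_initial_segment (fun j => val (e j)) p a (fun j => val_definable _)
    (Sigma_sg _ _ _ Hp)) as [H|[x [Hx1 Hx2]]].
  - apply (Lx _ (s_zero M) (val_emb _)) in H0. destruct (ev_not_and _ H0 H).
  - assert (Hx1' : forall y, s_lt M y (s_add M x (s_one M)) -> sat K (scons (emb y) e) p).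
    { intros y Hy; apply (Lx _ y (val_emb y)); revert Hx1; apply ev_mono; auto. }
    destruct Hx2 as [->|[Hxa Hx2]].
    + destruct (below_range M K emb ultrapower_PAminus ultrapower_end _ _ Hk) as [y <-].
      apply Hx1', (lt_succ_iff M HPA); left; apply emb_lt, Hk.
    + exfalso. apply (ev_not_and (fun i => sat M (scons (s_add M x (s_one M))
        (fun j => val (e j) i)) p)); [|exact Hx2].
      apply (Lx _ _ (val_emb _)).
      destruct ultrapower_embedding as [_ [_ [Hone [Hadd _]]]].
      rewrite Hadd, Hone. apply Hstep; [apply emb_lt, Hxa|].
      apply Hx1', (lt_succ M HPA).
Qed.

End Ultrapower.

(** * The equivalence for countable models *)

Lemma countable_surjection (M : structure) :
  countable M -> exists c : nat -> M, forall m, exists k, c k = m.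
Proof.
  intros [h Hh].
  exists (fun k => epsilon (inhabits (s_zero M)) (fun m => h m = k)). intros m; exists (h m).
  apply Hh. apply (epsilon_spec (inhabits (s_zero M)) (fun x => h x = h m)). eauto.
Qed.

Theorem theorem5p11 (M : structure) (n : nat) :
  countable M -> IDelta0_exp M ->
  (ISigma (S (S n)) M <->
   exists (K : structure) (f : M -> K),
     IDelta0_exp K /\
     end_extension M K f /\ proper M K f /\
     Sigma_elementary (S (S n)) M K f /\
     M_ISigma (S n) M K f).
Proof.
  intros Hcount [[HPA _] Hexp]; split.
  - intros HI. destruct (countable_surjection M Hcount) as [c Hc].
    destruct (generic_sequence M n HI c Hc) as [A [HA2 [HA3 HA4]]].
    exists (ultrapower M n c Hc A HA3), (emb M n c Hc A HA3).
    split; [split|split; [|split; [|split]]].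
    + apply ultrapower_IDelta0; auto.
    + apply ultrapower_exp; auto.
    + apply ultrapower_end; auto.
    + apply ultrapower_proper; auto.
    + apply ultrapower_elementary; auto.
    + apply ultrapower_M_ISigma; auto.
  - intros [K [f [[[HK _] _] [Hend [[d Hd] [Hel HI]]]]]].
    apply (end_extension_ISigma M K f n HPA HK Hend Hel d Hd HI).
Qed.
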